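(* Let $E$ be a translation-invariant Banach space of tempered distributions on $\mathbb{R}^n$. Let $g\in E$ and $\varphi\in \mathcal{S}(\mathbb{R}^n)$, and set $\varphi_{\varepsilon}(x)=\varepsilon^{-n}\varphi(x/\varepsilon)$ for $\varepsilon>0$. Then $$\lim_{\varepsilon\to 0^+} \|cg-\varphi_\varepsilon*g\|_E=0,\qquad\text{where } c=\int_{\mathbb{R}^n}\varphi(x)\,dx.$$
   Context: Notation: $(T_hg)(x)=g(x+h)$. $X\hookrightarrow Y$ means a dense and continuous linear embedding. A translation-invariant Banach space of tempered distributions is a Banach space $E$ such that: $(a)'$ $\mathcal{D}(\mathbb{R}^n)\hookrightarrow E\hookrightarrow \mathcal{D}'(\mathbb{R}^n)$; $(b)'$ $T_h(E)\subseteq E$ for every $h\in\mathbb{R}^{n}$; $(c)'$ for any $g\in E$ there are $M=M_g>0$, $\tau=\tau_{g}\geq 0$ with $\|T_{h} g\|_E\leq M(1+|h|)^\tau$ for all $h\in \mathbb{R}^n$. For such $E$ one has $\mathcal{S}(\mathbb{R}^n)\hookrightarrow E\hookrightarrow \mathcal{S}'(\mathbb{R}^n)$. For $\varphi\in\mathcal{S}(\mathbb{R}^n)$ and $g\in E$, the convolution $\varphi\ast g\in E$ is the continuous extension to $\mathcal{S}(\mathbb{R}^n)\times E\to E$ of the usual convolution on $\mathcal{S}(\mathbb{R}^n)\times\mathcal{S}(\mathbb{R}^n)$ (it coincides with the usual convolution of $\varphi\in\mathcal{S}(\mathbb{R}^n)$ with the tempered distribution $g$). *)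

(* Defs.v *)
From HB Require Import structures.
From mathcomp Require Import all_boot all_order all_algebra.
From mathcomp Require Import complex.
From mathcomp Require Import all_classical all_reals all_analysis.

Set Implicit Arguments.
Unset Strict Implicit.
Unset Printing Implicit Defensive.

Import Order.TTheory GRing.Theory Num.Theory.
Import numFieldNormedType.Exports.

Local Open Scope classical_set_scope.
Local Open Scope complex_scope.
Local Open Scope ring_scope.

(* R[i] is only declared as an algebraic structure in real-closed; it gets the
   norm and the topology that any numFieldType has over itself. *)
HB.instance Definition _ (R : realType) := GRing.ComAlgebra.copy R[i] R[i]^o.
HB.instance Definition _ (R : realType) := Vector.copy R[i] R[i]^o.
HB.instance Definition _ (R : realType) := NormedModule.copy R[i] R[i]^o.

Section LebesgueRn.
Context (R : realType).
Local Notation RT := (measurableTypeR R).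

Definition tuple_cons n (p : RT * n.-tuple RT) : n.+1.-tuple RT :=
  [tuple of p.1 :: p.2].

Lemma measurable_tuple_cons n : measurable_fun setT (@tuple_cons n).
Proof. exact: (@measurable_cons _ _ _ _ fst n snd). Qed.

Definition lebesgue_cons n
    (m : {sigma_finite_measure set (n.-tuple RT) -> \bar R}) :
    set (n.+1.-tuple RT) -> \bar R :=
  pushforward (@lebesgue_measure R \x m)%E (@tuple_cons n).

Section lebesgue_cons_measure.
Variables (n : nat) (m : {sigma_finite_measure set (n.-tuple RT) -> \bar R}).

Let lebesgue_cons0 : lebesgue_cons m set0 = 0%E.
Proof. by rewrite /lebesgue_cons /pushforward preimage_set0 measure0. Qed.

Let lebesgue_cons_ge0 A : (0 <= lebesgue_cons m A)%E.
Proof. by rewrite /lebesgue_cons /pushforward; exact: measure_ge0. Qed.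

Let lebesgue_cons_sigma_additive : semi_sigma_additive (lebesgue_cons m).
Proof.
move=> F mF tF mUF; rewrite /lebesgue_cons /pushforward preimage_bigcup.
have mpre A : measurable A -> measurable (@tuple_cons n @^-1` A).
  by move=> mA; rewrite -[X in measurable X]setTI; exact: measurable_tuple_cons.
apply: measure_semi_sigma_additive.
- by move=> k; exact: mpre.
- apply/trivIsetP => /= i j _ _ ij; rewrite -preimage_setI.
  by move/trivIsetP : tF => /(_ _ _ _ _ ij) ->//; rewrite preimage_set0.
- by rewrite -preimage_bigcup; exact: mpre.
Qed.

HB.instance Definition _ := isMeasure.Build _ _ _ (lebesgue_cons m)
  lebesgue_cons0 lebesgue_cons_ge0 lebesgue_cons_sigma_additive.

Let lebesgue_cons_sigma_finite : sigma_finite setT (lebesgue_cons m).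
Proof.
have /sigma_finiteP[F1 [TF1 ndF1 F1oo]] := sigma_finiteT (@lebesgue_measure R).
have /sigma_finiteP[F2 [TF2 ndF2 F2oo]] := sigma_finiteT m.
pose uncons (t : n.+1.-tuple RT) : RT * n.-tuple RT :=
  (thead t, [tuple of behead t]).
have muncons : measurable_fun setT uncons.
  by apply: measurable_fun_pair; [exact: measurable_tnth|exact: measurable_behead].
have unconsK p : uncons (tuple_cons p) = p.
  by case: p => x t; congr (_, _); exact: val_inj.
exists (fun k => uncons @^-1` (F1 k `*` F2 k)).
  rewrite -preimage_bigcup; apply/esym/seteqP; split=> // t _ /=.
  have [i _ Fi] : (\bigcup_i F1 i) (thead t) by rewrite -TF1.
  have [j _ Fj] : (\bigcup_i F2 i) [tuple of behead t] by rewrite -TF2.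
  exists (maxn i j) => //; split.
    by move/subsetPset: (ndF1 _ _ (leq_maxl i j)); exact.
  by move/subsetPset: (ndF2 _ _ (leq_maxr i j)); exact.
move=> k; have [mF1 F1k] := F1oo k; have [mF2 F2k] := F2oo k; split.
  rewrite -[X in measurable X]setTI; apply: muncons => //.
  exact: measurableX.
rewrite /lebesgue_cons /pushforward -comp_preimage.
rewrite (_ : uncons \o _ = id); last by apply/funext => p; exact: unconsK.
rewrite preimage_id product_measure1E//.
by rewrite lte_mul_pinfty// ge0_fin_numE.
Qed.

HB.instance Definition _ := Measure_isSigmaFinite.Build _ _ _ (lebesgue_cons m)
  lebesgue_cons_sigma_finite.

End lebesgue_cons_measure.

Fixpoint lebesgue_Rn n : {sigma_finite_measure set (n.-tuple RT) -> \bar R} :=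
  match n with
  | 0 => dirac [tuple]
  | m.+1 => lebesgue_cons (lebesgue_Rn m)
  end.

Definition row_of_tuple n (t : n.-tuple RT) : 'rV[R]_n := \row_i tnth t i.

Definition integral_Rn n (f : 'rV[R]_n -> R[i]) : R[i] :=
  (\int[lebesgue_Rn n]_t complex.Re (f (row_of_tuple t)))
  +i* (\int[lebesgue_Rn n]_t complex.Im (f (row_of_tuple t))).

End LebesgueRn.

Section Smooth.
Context (R : realType) (n : nat).
Implicit Types (f g : 'rV[R]_n -> R[i]) (s : seq 'I_n) (x h : 'rV[R]_n).

Definition enorm x : R := Num.sqrt (\sum_i x ord0 i ^+ 2).

Definition basis_vec (i : 'I_n) : 'rV[R]_n := delta_mx ord0 i.

Definition has_partial (i : 'I_n) f x :=
  derivable (@complex.Re R \o f) x (basis_vec i) /\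
  derivable (@complex.Im R \o f) x (basis_vec i).

Definition partial (i : 'I_n) f : 'rV[R]_n -> R[i] := fun x =>
  'D_(basis_vec i) (@complex.Re R \o f) x +i* 'D_(basis_vec i) (@complex.Im R \o f) x.

(* The sequence s plays the part of a multi-index of length size s. *)
Definition partials s f := foldr partial f s.

Definition smooth f := forall s,
  continuous (partials s f) /\ forall i x, has_partial i (partials s f) x.

Definition supp f : set 'rV[R]_n := closure [set x | f x != 0].

Definition translate h f : 'rV[R]_n -> R[i] := fun x => f (x + h).

Definition dilation (a : R) f : 'rV[R]_n -> R[i] := fun x => f (a *: x).

Lemma has_partial_lin i (a : R[i]) f g x :
  has_partial i f x -> has_partial i g x ->
  has_partial i (a *: f + g) x /\
  partial i (a *: f + g) x = a * partial i f x + partial i g x.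
Proof.
case: a => a b [df1 df2] [dg1 dg2].
have ReE : @complex.Re R \o ((a +i* b) *: f + g) =
    a *: (@complex.Re R \o f) + (- b) *: (@complex.Im R \o f)
    + (@complex.Re R \o g).
  apply/funext => y; rewrite !fctE/=; case: (f y) (g y) => [? ?] [? ?] /=.
  by rewrite -mulNr.
have ImE : @complex.Im R \o ((a +i* b) *: f + g) =
    a *: (@complex.Im R \o f) + b *: (@complex.Re R \o f)
    + (@complex.Im R \o g).
  by apply/funext => y; rewrite !fctE/=; case: (f y) (g y) => [? ?] [? ?].
have dlin (k l : R) (u v w : 'rV[R]_n -> R) :
    derivable u x (basis_vec i) -> derivable v x (basis_vec i) ->
    derivable w x (basis_vec i) ->
    is_derive x (basis_vec i) (k *: u + l *: v + w)
      (k *: 'D_(basis_vec i) u x + l *: 'D_(basis_vec i) v x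
       + 'D_(basis_vec i) w x).
  move=> /derivableP du /derivableP dv /derivableP dw.
  exact: (@is_deriveD _ _ _ _ _ _ _ _ _ (@is_deriveD _ _ _ _ _ _ _ _ _
    (@is_deriveZ _ _ _ _ k _ _ _ du) (@is_deriveZ _ _ _ _ l _ _ _ dv)) dw).
have [dRe DRe] := dlin a (- b) _ _ _ df1 df2 dg1.
have [dIm DIm] := dlin a b _ _ _ df2 df1 dg2.
split; first by rewrite /has_partial ReE ImE; split; [exact: dRe|exact: dIm].
rewrite /partial ReE ImE DRe DIm; simpc.
by congr (_ +i* _); rewrite /GRing.scale/= ?mulNr// [b * _ + _]addrC.
Qed.

Lemma partials_lin s (a : R[i]) f g : smooth f -> smooth g ->
  partials s (a *: f + g) = a *: partials s f + partials s g.
Proof.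
move=> sf sg; elim: s => [//|i s IH] /=; apply/funext => x.
by rewrite /= -/(partials _ _) IH (has_partial_lin _ ((sf s).2 i x) ((sg s).2 i x)).2.
Qed.

Lemma smooth_lin (a : R[i]) f g : smooth f -> smooth g -> smooth (a *: f + g).
Proof.
move=> sf sg s; rewrite partials_lin//; split => [x|i x].
  rewrite (_ : _ + _ = fun y => a *: partials s f y + partials s g y)//.
  exact: (@cvgD _ _ _ (nbhs x) _ _ _ _ _
    (@cvgZl_tmp _ _ _ (nbhs x) _ a _ _ ((sf s).1 x)) ((sg s).1 x)).
exact: (has_partial_lin _ ((sf s).2 i x) ((sg s).2 i x)).1.
Qed.

Lemma has_partial0 i x : has_partial i (0 : 'rV[R]_n -> R[i]) x.
Proof. by split; exact: derivable_cst. Qed.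

Lemma derive_rescale (a : R) (u : 'rV[R]_n -> R) (v x : 'rV[R]_n) : a != 0 ->
  derivable u (a *: x) v ->
  is_derive x v (u \o *:%R a) (a * 'D_v u (a *: x)).
Proof.
move=> a0 du.
pose q (y : 'rV[R]_n) (w : 'rV[R]_n -> R) (h : R) : R :=
  h^-1 *: ((w \o shift y) (h *: v) - w y).
have qE (h : R) : q x (u \o *:%R a) h = a * q (a *: x) u (a * h).
  have scaleE (k r : R) : k *: r = k * r by [].
  by rewrite /q /= [a *: (_ + _)]scalerDr scalerA !scaleE invfM !mulrA mulfV// mul1r.
have cva : ( *%R a) @ (0:R)^' --> (0:R)^'.
  move=> A [e /= e0 eA]; exists (e / `|a|) => /=.
    by rewrite divr_gt0// normr_gt0.
  move=> h /=; rewrite sub0r normrN => he h0.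
  apply: eA => /=; last by rewrite mulf_neq0.
  by rewrite sub0r normrN normrM mulrC -ltr_pdivlMr// normr_gt0.
have cvq : q x (u \o *:%R a) @ (0:R)^' --> a * 'D_v u (a *: x).
  rewrite (_ : q x _ = fun h : R => a * q (a *: x) u (a * h)); last exact/funext.
  exact: (@cvgMl_tmp _ _ _ _ (q (a *: x) u \o *%R a) _ _ (cvg_comp _ _ cva du)).
by apply: DeriveDef; [exact: cvgP cvq|exact: cvg_lim cvq].
Qed.

Lemma partials_dilation s (a : R) f : a != 0 -> smooth f ->
  partials s (dilation a f) = (a ^+ size s)%:C *: dilation a (partials s f).
Proof.
move=> a0 sf; elim: s => [|i s IH].
  by rewrite expr0 scale1r.
apply/funext => x; rewrite /= -/(partials _ _) IH.
have [dRe dIm] := (sf s).2 i (a *: x).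
have [pRe pIm] : has_partial i (dilation a (partials s f)) x /\
    partial i (dilation a (partials s f)) x = a%:C * partial i (partials s f) (a *: x).
  have [? DRe] := derive_rescale a0 dRe; have [? DIm] := derive_rescale a0 dIm.
  split; first by split.
  rewrite /partial -[RHS]/(a%:C * ('D__ _ _ +i* 'D__ _ _)); simpc.
  by congr (_ +i* _); [exact: DRe|exact: DIm].
have := has_partial_lin (a ^+ size s)%:C pRe (@has_partial0 i x).
rewrite addr0 => -[_ ->]; rewrite pIm fctE/= exprSr rmorphM/=.
rewrite {2}/partial !derive_cst addr0 mulrA /GRing.scale/=.
by [].
Qed.

Lemma partials0 s : partials s 0 = 0.
Proof.
elim: s => //= i s; rewrite -/(partials _ _) => ->.
by apply/funext => x; rewrite /partial !derive_cst.
Qed.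

Lemma smooth0 : smooth 0.
Proof.
move=> s; rewrite partials0; split=> [x|i x]; last exact: has_partial0.
exact: (@cvg_cst _ (0 : R[i]) _ (nbhs x)).
Qed.

Lemma smooth_dilation (a : R) f : a != 0 -> smooth f -> smooth (dilation a f).
Proof.
move=> a0 sf s; rewrite partials_dilation//; split => [x|i x].
  have cf : dilation a (partials s f) @ x --> dilation a (partials s f) x.
    apply: (@cvg_comp _ _ _ ( *:%R a) (partials s f) _ (nbhs (a *: x))).
      exact: (@cvgZl_tmp _ _ _ (nbhs x) _ a id _ cvg_id).
    exact: (sf s).1.
  exact: (@cvgZl_tmp _ _ _ (nbhs x) _ _ _ _ cf).
have [dRe dIm] := (sf s).2 i (a *: x).
have [? _] := derive_rescale a0 dRe; have [? _] := derive_rescale a0 dIm.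
have pd : has_partial i (dilation a (partials s f)) x by split.
have [pl _] := has_partial_lin (a ^+ size s)%:C pd (@has_partial0 i x).
by rewrite addr0 in pl. 
Qed.

Lemma translate_shift h f x v (p : R[i] -> R) :
  (fun t : R => t^-1 *: ((p \o translate h f \o shift x) (t *: v)
                        - (p \o translate h f) x)) =
  (fun t : R => t^-1 *: ((p \o f \o shift (x + h)) (t *: v) - (p \o f) (x + h))).
Proof. by apply/funext => t; rewrite /translate /= addrA. Qed.

Lemma partials_translate s h f :
  partials s (translate h f) = translate h (partials s f).
Proof.
elim: s => //= i s; rewrite -/(partials _ _) => ->; apply/funext => x.
by rewrite /partial /derive !translate_shift.
Qed.

Lemma smooth_translate h f : smooth f -> smooth (translate h f).
Proof.
move=> sf s; rewrite partials_translate; split => [x|i x].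
  apply: (@cvg_comp _ _ _ (fun y => y + h) (partials s f) _ (nbhs (x + h))).
    exact: (@cvgD _ _ _ (nbhs x) _ id (cst h) _ _ cvg_id (cvg_cst _)).
  exact: (sf s).1.
by rewrite /has_partial /derivable !translate_shift; exact: (sf s).2.
Qed.

Lemma supp_translate h f x : supp (translate h f) x <-> supp f (x + h).
Proof.
have tr k : continuous (fun y : 'rV[R]_n => y + k).
  by move=> y; exact: (@cvgD _ _ _ (nbhs y) _ id (cst k) _ _ cvg_id (cvg_cst _)).
split=> [sx B Bx|sx B Bx].
  have [y [/= fy By]] := sx _ (tr h x _ Bx).
  by exists (y + h); split.
have /sx[y [/= fy By]] : nbhs (x + h) ((fun y => y - h) @^-1` B).
  by apply: tr; rewrite addrK.
by exists (y - h); split => //=; rewrite /translate subrK.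
Qed.

Lemma compact_supp_translate h f :
  compact (supp f) -> compact (supp (translate h f)).
Proof.
move=> cf.
rewrite (_ : supp _ = (fun y => y - h) @` supp f); last first.
  apply/seteqP; split => [x /supp_translate sx|_ [y fy <-]].
    by exists (x + h) => //; rewrite addrK.
  by apply/supp_translate; rewrite subrK.
apply: continuous_compact cf; apply: continuous_subspaceT => y.
exact: (@cvgD _ _ _ (nbhs y) _ id (cst (- h)) _ _ cvg_id (cvg_cst _)).
Qed.

Lemma compact_suppS f (K : set 'rV[R]_n) :
  compact K -> (forall x, f x != 0 -> K x) -> compact (supp f).
Proof.
move=> cK fK; apply: (subclosed_compact (@closed_closure _ _) cK).
have /closure_id -> := compact_closed (@norm_hausdorff _ _) cK.
exact: closureS.
Qed.

End Smooth.

Section TestFunctions.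
Context (R : realType) (n : nat).

Definition test_function_pred : {pred 'rV[R]_n -> R[i]} :=
  [pred f | `[< smooth f /\ compact (supp f) >]].

Lemma test_functionP (f : 'rV[R]_n -> R[i]) :
  reflect (smooth f /\ compact (supp f)) (f \in test_function_pred).
Proof. exact: asboolP. Qed.

Lemma test_function_submod_closed : GRing.submod_closed test_function_pred.
Proof.
split=> [|a f g /test_functionP[sf cf] /test_functionP[sg cg]].
  apply/test_functionP; split; first exact: smooth0.
  by apply: (@compact_suppS _ _ _ set0) => [|x /eqP//]; exact: compact0.
apply/test_functionP; split; first exact: smooth_lin.
apply: (compact_suppS (compactU cf cg)) => x; apply: contraNP => /not_orP[fx gx].
have f0 : f x = 0.
  by apply: contrapT => /eqP f0; apply: fx; exact: subset_closure.
have g0 : g x = 0.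
  by apply: contrapT => /eqP g0; apply: gx; exact: subset_closure.
by rewrite fctE /= -[(a *: f) x]/(a *: f x) f0 g0 scaler0 addr0.
Qed.

HB.instance Definition _ := GRing.isSubmodClosed.Build R[i]
  ('rV[R]_n -> R[i]) test_function_pred test_function_submod_closed.

Record test_function := TestFunction {
  test_fun :> 'rV[R]_n -> R[i] ;
  _ : test_fun \in test_function_pred }.

HB.instance Definition _ := [isSub for test_fun].
HB.instance Definition _ := [Choice of test_function by <:].
HB.instance Definition _ := [SubChoice_isSubLmodule of test_function by <:].

Local Notation D := test_function.

Definition absolutely_convex (V : set D) := forall (a b : R[i]) (phi psi : D),
  `|a| + `|b| <= 1 -> V phi -> V psi -> V (a *: phi + b *: psi).

Definition zero_nbhs_DK (K : set 'rV[R]_n) (V : set D) :=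
  exists (N : nat) (e : R), 0 < e /\ forall phi : D, supp phi `<=` K ->
    (forall s x, (size s <= N)%N -> `|partials s phi x| <= e%:C) -> V phi.

(* The absolutely convex sets whose trace on every D_K is a neighbourhood of 0
   form a base of neighbourhoods of 0 for the finest locally convex topology
   that makes all the inclusions D_K -> D continuous. *)
Definition zero_nbhs_D (V : set D) := absolutely_convex V /\
  forall K, compact K -> zero_nbhs_DK K V.

Definition open_D (U : set D) := forall phi, U phi ->
  exists2 V, zero_nbhs_D V & forall psi, V psi -> U (phi + psi).

Let open_DT : open_D setT.
Proof.
move=> phi _; exists setT => //; split=> // K _.
by exists 0%N, 1.
Qed.

Let open_DI : setI_closed open_D.
Proof.
move=> U1 U2 oU1 oU2 phi [/oU1[V1 [aV1 zV1] VU1] /oU2[V2 [aV2 zV2] VU2]].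
exists (V1 `&` V2); last by move=> psi [/VU1 ? /VU2].
split=> [a b f g ab [f1 f2] [g1 g2]|K cK].
  by split; [exact: aV1|exact: aV2].
have [N1 [e1 [e10 H1]]] := zV1 K cK; have [N2 [e2 [e20 H2]]] := zV2 K cK.
exists (maxn N1 N2), (Num.min e1 e2); split; first by rewrite lt_min e10.
move=> psi sK H; split.
- apply: H1 => // s x sN; apply: le_trans (H s x _) _.
    by rewrite (leq_trans sN)// leq_maxl.
  by rewrite lecR ge_min lexx.
- apply: H2 => // s x sN; apply: le_trans (H s x _) _.
    by rewrite (leq_trans sN)// leq_maxr.
  by rewrite lecR ge_min lexx orbT.
Qed.

Let open_D_bigU (I : Type) (f : I -> set D) :
  (forall i, open_D (f i)) -> open_D (\bigcup_i f i).
Proof.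
move=> of_ phi [i _ /of_[V zV VU]]; exists V => // psi /VU ?.
by exists i.
Qed.

HB.instance Definition _ := isOpenTopological.Build D
  open_DT open_DI open_D_bigU.

Definition bounded_D (B : set D) := forall V : set D, nbhs 0 V ->
  exists2 r : R, 0 < r & forall (a : R[i]) (phi : D),
    r%:C <= `|a| -> B phi -> exists2 psi, V psi & phi = a *: psi.

Definition translate_D_subproof (h : 'rV[R]_n) (phi : D) :
  translate h phi \in test_function_pred.
Proof.
have /test_functionP[sp cp] := valP phi.
by apply/test_functionP; split;
  [exact: smooth_translate|exact: compact_supp_translate].
Qed.

Definition translate_D (h : 'rV[R]_n) (phi : D) : D :=
  TestFunction (translate_D_subproof h phi).

End TestFunctions.

Section Distributions.
Context (R : realType) (n : nat).
Local Notation D := (@test_function R n).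

Definition distribution_pred : {pred D -> R[i]} :=
  [pred T | `[< linear T /\ continuous T >]].

Lemma distributionP (T : D -> R[i]) :
  reflect (linear T /\ continuous T) (T \in distribution_pred).
Proof. exact: asboolP. Qed.

Lemma distribution_submod_closed : GRing.submod_closed distribution_pred.
Proof.
split=> [|a S T /distributionP[lS cS] /distributionP[lT cT]].
  apply/distributionP; split => [k u v|x]; first by rewrite scaler0 addr0.
  exact: (@cvg_cst _ (0 : R[i]) _ (nbhs x)).
apply/distributionP; split => [k u v|x].
  have E w : (a *: S + T) w = a *: S w + T w by [].
  rewrite !E lS lT.
  by rewrite !scalerDr !scalerA [a * k]mulrC !addrA; congr (_ + _); rewrite addrAC.
exact: (@cvgD _ _ _ (nbhs x) _ _ _ _ _
  (@cvgZl_tmp _ _ _ (nbhs x) _ a _ _ (cS x)) (cT x)).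
Qed.

HB.instance Definition _ := GRing.isSubmodClosed.Build R[i]
  (D -> R[i]) distribution_pred distribution_submod_closed.

Record distrib := Distrib {
  dist_fun :> D -> R[i] ;
  _ : dist_fun \in distribution_pred }.

HB.instance Definition _ := [isSub for dist_fun].
HB.instance Definition _ := [Choice of distrib by <:].
HB.instance Definition _ := [SubChoice_isSubLmodule of distrib by <:].

(* Strong dual topology: uniform convergence on the bounded subsets of D. *)
Definition open_D' (U : set distrib) := forall T, U T ->
  exists (B : set D) (e : R), [/\ bounded_D B, 0 < e &
    forall S : distrib,
      (forall phi, B phi -> `|S phi - T phi| <= e%:C) -> U S].

Let open_D'T : open_D' setT.
Proof.
by move=> T _; exists set0, 1; split=> // V _; exists 1.
Qed.

Let open_D'I : setI_closed open_D'.
Proof.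
move=> U1 U2 oU1 oU2 T [/oU1[B1 [e1 [bB1 e10 H1]]] /oU2[B2 [e2 [bB2 e20 H2]]]].
exists (B1 `|` B2), (Num.min e1 e2); split; last 1 first.
- move=> S H; split; [apply: H1 => phi Bp|apply: H2 => phi Bp];
    (apply: le_trans (H phi _) _; first by [left|right]);
    by rewrite lecR ge_min lexx ?orbT.
- move=> V V0; have [r1 r10 G1] := bB1 V V0; have [r2 r20 G2] := bB2 V V0.
  exists (Num.max r1 r2); first by rewrite lt_max r10.
  move=> a phi ra [|]; [apply: G1|apply: G2];
    by apply: le_trans ra; rewrite lecR le_max lexx ?orbT.
- by rewrite lt_min e10.
Qed.

Let open_D'_bigU (I : Type) (f : I -> set distrib) :
  (forall i, open_D' (f i)) -> open_D' (\bigcup_i f i).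
Proof.
move=> of_ T [i _ /of_[B [e [bB e0 H]]]]; exists B, e; split=> // S /H ?.
by exists i.
Qed.

HB.instance Definition _ := isOpenTopological.Build distrib
  open_D'T open_D'I open_D'_bigU.

End Distributions.

Section Schwartz.
Context (R : realType) (n : nat).

Definition schwartz_pred : {pred 'rV[R]_n -> R[i]} :=
  [pred f | `[< smooth f /\ forall (N : nat) (s : seq 'I_n), exists M : R,
    forall x, ((1 + enorm x) ^+ N)%:C * `|partials s f x| <= M%:C >]].

Lemma schwartzP (f : 'rV[R]_n -> R[i]) :
  reflect (smooth f /\ forall (N : nat) (s : seq 'I_n), exists M : R,
    forall x, ((1 + enorm x) ^+ N)%:C * `|partials s f x| <= M%:C)
    (f \in schwartz_pred).
Proof. exact: asboolP. Qed.

Lemma enorm_ge0 (x : 'rV[R]_n) : 0 <= enorm x.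
Proof. exact: sqrtr_ge0. Qed.

Lemma enormZ (a : R) (x : 'rV[R]_n) : enorm (a *: x) = `|a| * enorm x.
Proof.
rewrite /enorm -sqrtr_sqr -sqrtrM ?sqr_ge0// mulr_sumr.
by congr Num.sqrt; apply: eq_bigr => i _; rewrite mxE exprMn.
Qed.

Lemma weight_ge0 N (x : 'rV[R]_n) : 0 <= ((1 + enorm x) ^+ N)%:C.
Proof. by rewrite lecR exprn_ge0// addr_ge0// enorm_ge0. Qed.

Lemma schwartz_submod_closed : GRing.submod_closed schwartz_pred.
Proof.
split=> [|a f g /schwartzP[sf bf] /schwartzP[sg bg]]; apply/schwartzP.
  split; first exact: smooth0.
  by move=> N s; exists 0 => x; rewrite partials0 normr0 mulr0.
split; first exact: smooth_lin.
move=> N s; have [Mf Hf] := bf N s; have [Mg Hg] := bg N s.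
exists (complex.Re `|a| * Mf + Mg) => x; rewrite partials_lin//.
have aE : (complex.Re `|a|)%:C = `|a| by rewrite RRe_real ?normr_real.
rewrite (le_trans (ler_wpM2l (weight_ge0 N x) (ler_normD _ _)))//.
rewrite mulrDr rmorphD lerD// rmorphM/= aE -[(a *: _) x]/(a * _) normrM mulrCA.
exact: ler_wpM2l.
Qed.

HB.instance Definition _ := GRing.isSubmodClosed.Build R[i]
  ('rV[R]_n -> R[i]) schwartz_pred schwartz_submod_closed.

Record schwartz := Schwartz {
  schwartz_fun :> 'rV[R]_n -> R[i] ;
  _ : schwartz_fun \in schwartz_pred }.

HB.instance Definition _ := [isSub for schwartz_fun].
HB.instance Definition _ := [Choice of schwartz by <:].
HB.instance Definition _ := [SubChoice_isSubLmodule of schwartz by <:].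

Local Notation S := schwartz.

Definition open_S (U : set S) := forall phi, U phi ->
  exists (N : nat) (e : R), 0 < e /\ forall psi : S,
    (forall s x, (size s <= N)%N ->
      ((1 + enorm x) ^+ N)%:C * `|partials s psi x| <= e%:C) ->
    U (phi + psi).

Let open_ST : open_S setT.
Proof. by move=> phi _; exists 0%N, 1. Qed.

Let open_SI : setI_closed open_S.
Proof.
move=> U1 U2 oU1 oU2 phi [/oU1[N1 [e1 [e10 H1]]] /oU2[N2 [e2 [e20 H2]]]].
exists (maxn N1 N2), (Num.min e1 e2); split; first by rewrite lt_min e10.
have wle N N' (x : 'rV[R]_n) : (N <= N')%N ->
    ((1 + enorm x) ^+ N)%:C <= ((1 + enorm x) ^+ N')%:C.
  by move=> NN'; rewrite lecR ler_weXn2l// lerDl enorm_ge0.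
move=> psi H; split; [apply: H1 => s x sN|apply: H2 => s x sN].
- have N1N := leq_maxl N1 N2.
  apply: (le_trans (ler_wpM2r (normr_ge0 _) (wle _ _ x N1N))).
  apply: (le_trans (H s x (leq_trans sN N1N))).
  by rewrite lecR ge_min lexx.
- have N2N := leq_maxr N1 N2.
  apply: (le_trans (ler_wpM2r (normr_ge0 _) (wle _ _ x N2N))).
  apply: (le_trans (H s x (leq_trans sN N2N))).
  by rewrite lecR ge_min lexx orbT.
Qed.

Let open_S_bigU (I : Type) (f : I -> set S) :
  (forall i, open_S (f i)) -> open_S (\bigcup_i f i).
Proof.
move=> of_ phi [i _ /of_[N [e [e0 H]]]]; exists N, e; split=> // psi /H ?.
by exists i.
Qed.

HB.instance Definition _ := isOpenTopological.Build S
  open_ST open_SI open_S_bigU.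

Lemma schwartz_dilation (a : R) (f : 'rV[R]_n -> R[i]) :
  a != 0 -> f \in schwartz_pred -> dilation a f \in schwartz_pred.
Proof.
move=> a0 /schwartzP[sf bf]; apply/schwartzP.
split; first exact: smooth_dilation.
move=> N s; have [M HM] := bf N s.
pose C : R := 1 + `|a|^-1.
have C0 : 0 <= C by rewrite addr_ge0// invr_ge0.
have wle (x : 'rV[R]_n) : 1 + enorm x <= C * (1 + enorm (a *: x)).
  rewrite enormZ /C mulrDr mulr1 mulrDl mul1r mulrA mulVf ?normr_eq0// mul1r.
  rewrite -addrA lerD2l addrA addrC ler_wpDr// addr_ge0 ?invr_ge0//.
  by rewrite mulr_ge0// enorm_ge0.
exists (C ^+ N * `|a| ^+ size s * M) => x.
rewrite partials_dilation// -[(_ *: _) x]/(_ * partials s f (a *: x)).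
rewrite normrM normc_def/= expr0n addr0 sqrtr_sqr normrX.
have wleN : ((1 + enorm x) ^+ N)%:C <= (C ^+ N)%:C * ((1 + enorm (a *: x)) ^+ N)%:C.
  rewrite -rmorphM lecR -exprMn; apply: lerXn2r; rewrite ?nnegrE//.
  - by rewrite addr_ge0// enorm_ge0.
  - by rewrite mulr_ge0// addr_ge0// enorm_ge0.
rewrite !rmorphM/= mulrCA.
rewrite [in leRHS]mulrAC [in leRHS]mulrC ler_wpM2l//.
  by rewrite lecR exprn_ge0.
apply: (le_trans (ler_wpM2r (normr_ge0 _) wleN)).
by rewrite -mulrA ler_wpM2l// lecR exprn_ge0.
Qed.

Lemma rescale_subproof (eps : R) (phi : S) :
  (eps ^- n)%:C *: dilation eps^-1 phi \in schwartz_pred.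
Proof.
have [->|e0] := eqVneq eps 0; last first.
  by apply: rpredZ; apply: schwartz_dilation; [rewrite invr_eq0|exact: valP].
case: (posnP n) => [n0|n0]; last first.
  by rewrite expr0n gtn_eqF// invr0 scale0r rpred0.
rewrite (_ : dilation _ _ = phi); first by apply: rpredZ; exact: valP.
apply/funext => x; congr (schwartz_fun phi _); apply/rowP => i.
by exfalso; move: (leq_ltn_trans (leq0n _) (ltn_ord i)); rewrite n0.
Qed.

(* x |-> eps^-n phi(x/eps); the value at eps = 0 is immaterial *)
Definition rescale (eps : R) (phi : S) : S :=
  Schwartz (rescale_subproof eps phi).

Definition convolution_fun (f g : 'rV[R]_n -> R[i]) : 'rV[R]_n -> R[i] :=
  fun x => integral_Rn (fun y => f (x - y) * g y).

End Schwartz.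

Section TranslationInvariant.
Context (R : realType) (n : nat).
Local Notation D := (test_function R n).
Local Notation D' := (distrib R n).
Local Notation S := (schwartz R n).

(* T is the distribution of the function f; this is how functions are
   identified with distributions. *)
Definition is_regular (f : 'rV[R]_n -> R[i]) (T : D') :=
  forall phi : D, T phi = integral_Rn (fun x => f x * phi x).

(* T' = T_h T, i.e. T'(x) = T(x + h) *)
Definition is_translate (h : 'rV[R]_n) (T T' : D') :=
  forall phi : D, T' phi = T (translate_D (- h) phi).

(* The Banach space of distributions is presented by an abstract Banach space E
   and the inclusion iota of E into D'. *)
Record translation_invariant (E : completeNormedModType R[i])
    (iota : {linear E -> D'}) : Prop := TranslationInvariant {
  iota_inj : injective iota ;
  iota_continuous : continuous iota ;
  iota_dense : dense (range iota) ;
  test_embedding : exists j : {linear D -> E},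
    [/\ forall phi : D, is_regular phi (iota (j phi)),
        continuous j & dense (range j)] ;
  translation_closed : forall (h : 'rV[R]_n) (g : E),
    exists g' : E, is_translate h (iota g) (iota g') ;
  translation_growth : forall g : E, exists M tau : R,
    [/\ 0 < M, 0 <= tau & forall (h : 'rV[R]_n) (g' : E),
      is_translate h (iota g) (iota g') ->
      `|g'| <= (M * (1 + enorm h) `^ tau)%:C] }.

(* k is the continuous extension to S x E of the convolution on S x S. *)
Definition is_convolution (E : completeNormedModType R[i])
    (iota : {linear E -> D'}) (k : S -> E -> E) :=
  continuous (fun p : S * E => k p.1 p.2) /\
  forall (phi psi : S) (e : E), is_regular psi (iota e) ->
    is_regular (convolution_fun phi psi) (iota (k phi e)).

End TranslationInvariant.

(* Main.v *)
Require Import Defs.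
From HB Require Import structures.
From mathcomp Require Import all_boot all_order all_algebra.
From mathcomp Require Import complex.
From mathcomp Require Import all_classical all_reals all_analysis.
From mathcomp Require Import measurable_realfun.
From mathcomp Require Import ring lra.

Set Implicit Arguments.
Unset Strict Implicit.
Unset Printing Implicit Defensive.

Import Order.TTheory GRing.Theory Num.Theory.
Import numFieldNormedType.Exports.

Local Open Scope classical_set_scope.
Local Open Scope complex_scope.
Local Open Scope ring_scope.

(* For the dense set of g coming from test functions, c g - phi_eps * g is the
   integral of phi(y) (g - T_(-eps y) g) over y. By Baire's theorem the norm of
   T_h on E is at most C (1 + |h|)^m, so this integral is at most a constant
   times the norm of g, uniformly in eps <= 1, which reduces the claim to g
   coming from a test function. There T_h g -> g as h -> 0 because the embedding
   of test functions in E is continuous; for eps y away from 0 the polynomial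
   growth is absorbed by one more power of the weight. The vector-valued
   integral is only ever seen through its pairings with test functions, which
   is enough to bound the norm of its value. *)

(** * Real-valued norms and Baire's theorem *)

(** The growth condition gives constants that depend on [g], and it does not say that a single
    translation is continuous on [E], so uniform boundedness does not apply directly. Linearity of
    translations comes from uniqueness of translates, and pairing with test functions does the work
    of a closed graph argument. Likewise [is_convolution] does not state that [star] is additive in
    its second argument: the integral formula is established on the range of [j], and estimates pass
    to [E] by continuity and density. The extra power of the weight makes the weighted difference a
    continuous function that vanishes at infinity; such a function is uniformly close to functions
    with finitely many values, and finite sums replace the vector-valued integral. The factors 2 in
    the norm bounds come from treating real and imaginary parts separately. *)

Section RealNorm.
Context (R : realType) (V : normedModType R[i]).
Implicit Types (x y z : V).

(** Over [R[i]] norms are valued in [R[i]]; the real part is the same number in the totally ordered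
    field [R], where [lra] and real limits are available. *)
Definition nrm x : R := complex.Re `|x|.

Lemma nrmE x : `|x| = (nrm x)%:C.
Proof. by rewrite /nrm RRe_real ?ger0_real ?normr_ge0. Qed.

Lemma nrm_ge0 x : 0 <= nrm x.
Proof. by rewrite -lecR -nrmE normr_ge0. Qed.

Lemma nrm0 : nrm 0 = 0.
Proof. by rewrite /nrm normr0. Qed.

Lemma nrm_eq0 x : (nrm x == 0) = (x == 0).
Proof. by rewrite -[x == 0]normr_eq0 nrmE; apply/eqP/eqP => [->//|[]]. Qed.

Lemma nrmN x : nrm (- x) = nrm x.
Proof. by rewrite /nrm normrN. Qed.

Lemma nrmBC x y : nrm (x - y) = nrm (y - x).
Proof. by rewrite /nrm distrC. Qed.

Lemma nrmD x y : nrm (x + y) <= nrm x + nrm y.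
Proof. by rewrite -lecR (rmorphD (real_complex R)) /= -!nrmE ler_normD. Qed.

Lemma nrmB x y : nrm (x - y) <= nrm x + nrm y.
Proof. by rewrite -(nrmN y) nrmD. Qed.

Lemma nrm_tri z x y : nrm (x - y) <= nrm (x - z) + nrm (z - y).
Proof. by rewrite -{1}(subrK z x) -addrA nrmD. Qed.

Lemma nrmZ (a : R[i]) x : nrm (a *: x) = complex.Re `|a| * nrm x.
Proof. by rewrite {1}/nrm normrZ [`|x|]nrmE -[`|a|]RRe_real ?ger0_real ?normr_ge0//= mulr0 subr0. Qed.

Lemma nrmZr (a : R) x : nrm (a%:C *: x) = `|a| * nrm x.
Proof. by rewrite nrmZ normc_def/= expr0n addr0 sqrtr_sqr. Qed.

Lemma nrm_sum (I : Type) (s : seq I) (F : I -> V) :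
  nrm (\sum_(i <- s) F i) <= \sum_(i <- s) nrm (F i).
Proof.
elim/big_ind2: _ => [|u a v b ua vb|//]; first by rewrite nrm0.
by rewrite (le_trans (nrmD _ _))// lerD.
Qed.

Lemma nbhs_nrm x (A : set V) :
  nbhs x A <-> exists2 r : R, 0 < r & forall y, nrm (x - y) < r -> A y.
Proof.
split=> [/nbhs_normP[e /= e0 eA]|[r r0 rA]].
  have er : e = (complex.Re e)%:C by rewrite RRe_real// gtr0_real.
  exists (complex.Re e); first by rewrite -ltcR -er.
  by move=> y xy; apply: eA => /=; rewrite nrmE er ltcR.
apply/nbhs_normP; exists r%:C => /=; first by rewrite ltcR.
by move=> y /=; rewrite nrmE ltcR; exact: rA.
Qed.

Lemma cvg_nrmP (T : Type) (F : set_system T) (f : T -> V) (l : V) :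
  Filter F -> f @ F --> l <->
  forall e : R, 0 < e -> \forall t \near F, nrm (l - f t) < e.
Proof.
move=> FF; split=> [fl e e0|fl A /nbhs_nrm[r r0 rA]].
  by apply: (fl [set y | nrm (l - y) < e]); apply/nbhs_nrm; exists e.
by apply: filterS (fl r r0) => t; exact: rA.
Qed.

Lemma nrm_continuous : continuous nrm.
Proof.
move=> x; apply/(@cvgrPdist_lt R R) => e e0; near=> y.
have xy : nrm (x - y) < e by near: y; apply/nbhs_nrm; exists e.
have h1 := nrmD (x - y) y; have h2 := nrmD (y - x) x.
rewrite subrK in h1; rewrite subrK nrmBC in h2.
rewrite ltr_norml; apply/andP; split; lra.
Unshelve. all: by end_near. Qed.

(** Non-strict bounds survive limits where [f] is continuous; [defect_lipschitz] leaves the dense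
    range of [j] this way. *)
Lemma closed_nrm_le (f : V -> R) (k : R) x : {for x, continuous f} ->
  (forall e : R, 0 < e -> exists2 y, nrm (x - y) < e & f y <= k) -> f x <= k.
Proof.
move=> cf H; rewrite leNgt; apply/negP => kfx.
have /nbhs_nrm[r r0 rH] : \forall y \near x, k < f y.
  by apply: (cf [set z | k < z]); apply: lt_nbhsr.
have [y xy yk] := H r r0.
by have := rH y xy; rewrite ltNge yk.
Qed.

End RealNorm.

Lemma nrm_inv_natP (R : realType) (e : R) : 0 < e ->
  exists N : nat, forall k, (N <= k)%N -> k.+1%:R^-1 < e.
Proof.
move=> e0; exists (Num.truncn e^-1) => k Nk.
rewrite -ltf_pV2 ?(posrE,invr_gt0)// invrK.
by rewrite (lt_le_trans (truncnS_gt _))// ler_nat ltnS.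
Qed.

Section Complete.
Context (R : realType) (E : completeNormedModType R[i]).

Lemma complete_nrm (u : nat -> E) :
  (forall e : R, 0 < e -> exists N : nat, forall k l, (N <= k)%N -> (N <= l)%N ->
     nrm (u k - u l) < e) ->
  exists l : E, u @ \oo --> l.
Proof.
move=> cu; suff /cauchy_cvg : cauchy (u @ \oo).
  by move=> /cvg_ex.
apply/cauchy_ballP => e e0.
have er : e = (complex.Re e)%:C by rewrite RRe_real// gtr0_real.
have e0' : 0 < complex.Re e by rewrite -ltcR -er.
have [N HN] := cu _ e0'.
exists (u @` [set k | (N <= k)%N], u @` [set k | (N <= k)%N]).
  by split; exists N => // k Nk; exists k.
move=> [_ _] /= [[k Nk <-] [l Nl <-]].
by rewrite -ball_normE /ball_/= nrmE er ltcR; exact: HN.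
Qed.

(* The library's Baire theorem is about real scalars only. *)
Lemma baire_cover (B : nat -> set E) : (forall x, exists k, B k x) ->
  exists k (x : E) (r : R), 0 < r /\
    forall y, nrm (x - y) < r -> forall e : R, 0 < e ->
      exists2 b, B k b & nrm (y - b) < e.
Proof.
move=> covB; apply: contrapT => nB.
(* One shrinking step: inside the ball [p.2], a closed ball that misses [B p.1]. Positivity of the
   radius is a premise inside the existential, so that [choice] yields a total function. *)
have step (p : nat * (E * R)) : exists q : E * R, 0 < p.2.2 ->
    [/\ 0 < q.2, q.2 < p.1.+1%:R^-1,
        forall y, nrm (q.1 - y) <= q.2 -> nrm (p.2.1 - y) <= p.2.2 &
        forall y, nrm (q.1 - y) <= q.2 -> ~ B p.1 y].
  case: p => k [x r] /=; have [r0|r0] := ltP 0 r; last by exists (x, r).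
  apply: contrapT => nq; apply: nB; exists k, x, (r / 2); split.
    by rewrite divr_gt0.
  move=> y xy e e0; apply: contrapT => nb; apply: nq.
  (* [r / 2] keeps the new ball inside the old one, [e / 2] keeps it away from [B k], and the last
     bound forces the radii to 0. *)
  have [q [q0 q1 q2 q3]] : exists q : R,
      [/\ 0 < q, q <= r / 2, q <= e / 2 & q <= k.+1%:R^-1 / 2].
    exists (Num.min (Num.min (r / 2) (e / 2)) (k.+1%:R^-1 / 2)).
    by rewrite !lt_min !ge_min !lexx ?orbT !divr_gt0.
  have k0 : 0 < k.+1%:R^-1 :> R by [].
  exists (y, q) => _; split => //=.
  - by move: q3 k0; move: (_.+1%:R^-1) => K; lra.
  - by move=> z yz; have := nrm_tri y x z; lra.
  - by move=> z yz Bz; apply: nb; exists z => //; lra.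
have [f Hf] := choice step.
pose fix a n := if n is m.+1 then f (m, a m) else (0, 1).
have apos n : 0 < (a n).2.
  by elim: n => [|n IH] /=; [exact: ltr01|have [] := Hf (n, a n) IH].
have aS n := Hf (n, a n) (apos n).
have sub n m y : (n <= m)%N -> nrm ((a m).1 - y) <= (a m).2 ->
    nrm ((a n).1 - y) <= (a n).2.
  elim: m => [|m IH]; first by rewrite leqn0 => /eqP ->.
  rewrite leq_eqVlt => /predU1P[->//|nm] H; apply: IH => //.
  by have [_ _ + _] := aS m; apply.
have self n m : (n <= m)%N -> nrm ((a n).1 - (a m).1) <= (a n).2.
  by move=> nm; apply: (sub n m) => //; rewrite subrr nrm0 ltW.
have [l al] : exists l : E, (fun n => (a n).1) @ \oo --> l.
  apply: complete_nrm => e e0.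
  have [N HN] := nrm_inv_natP (divr_gt0 e0 (ltr0Sn R 1)).
  exists N.+1 => k l Nk Nl; have := nrm_tri (a N.+1).1 (a k).1 (a l).1.
  have rN : (a N.+1).2 < e / 2.
    by have [_ rN _ _] := aS N; exact: lt_trans rN (HN N (leqnn _)).
  have := self _ _ Nk; have := self _ _ Nl.
  by rewrite [nrm ((a k).1 - (a N.+1).1)]nrmBC; lra.
(* The limit lies in every closed ball of the sequence, whereas ball [k.+1] misses [B k]. *)
have [k Bk] := covB l.
have [_ _ _ /(_ l) /=] := aS k; apply => //.
rewrite -[f _]/(a k.+1).
apply/ler_addgt0Pl => e e0.
have [N _ HN] := (cvg_nrmP _ _ _).1 al e e0.
have := HN (maxn N k.+1) (leq_maxl _ _) => /= h1.
have := self k.+1 (maxn N k.+1) (leq_maxr _ _).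
have := nrm_tri (a (maxn N k.+1)).1 (a k.+1).1 l.
by rewrite [nrm ((a (maxn _ _)).1 - l)]nrmBC; lra.
Qed.

End Complete.

(** * Test functions *)

Section RealContinuous.
Context (R : realType) (T : topologicalType).
Implicit Types f g : T -> R.

Lemma continuous_add f g : continuous f -> continuous g ->
  continuous (fun x => f x + g x).
Proof. by move=> cf cg x; exact: (@continuousD _ R _ f g x (cf x) (cg x)). Qed.

Lemma continuous_mul f g : continuous f -> continuous g ->
  continuous (fun x => f x * g x).
Proof. by move=> cf cg x; exact: (@continuousM _ _ f g x (cf x) (cg x)). Qed.

Lemma continuous_exp f N : continuous f -> continuous (fun x => f x ^+ N).
Proof.
move=> cf; elim: N => [|N IH].
  by under eq_fun do rewrite expr0; exact: cst_continuous.
by under eq_fun do rewrite exprS; exact: continuous_mul.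
Qed.

Lemma continuous_sumr (I : Type) (s : seq I) (F : I -> T -> R) :
  (forall i, continuous (F i)) -> continuous (fun x => \sum_(i <- s) F i x).
Proof.
move=> cF; elim: s => [|i s IH].
  rewrite (_ : (fun _ => _) = cst 0); first exact: cst_continuous.
  by apply/funext => x; rewrite big_nil.
rewrite (_ : (fun _ => _) = fun x => F i x + \sum_(i <- s) F i x).
  exact: continuous_add.
by apply/funext => x; rewrite big_cons.
Qed.

End RealContinuous.

Section EuclideanNorm.
Context (R : realType) (n : nat).
Implicit Types x y : 'rV[R]_n.

Lemma coord_le_enorm x i : `|x ord0 i| <= enorm x.
Proof.
rewrite -sqrtr_sqr /enorm ler_sqrt ?sumr_ge0// => [|j _]; last exact: sqr_ge0.
by rewrite (bigD1 i)//= lerDl sumr_ge0// => j _; exact: sqr_ge0.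
Qed.

Lemma norm_le_enorm x : `|x| <= enorm x.
Proof.
rewrite -[`|x|]/(mx_norm x) mx_normrE; apply/bigmax_leP; split; first exact: enorm_ge0.
by move=> [i j] _ /=; rewrite (ord1 i); exact: coord_le_enorm.
Qed.

Lemma enorm_continuous : continuous (@enorm R n).
Proof.
move=> x; apply: (@continuous_comp _ _ _
  (fun y : 'rV[R]_n => \sum_i y ord0 i ^+ 2) Num.sqrt); last exact: sqrt_continuous.
apply: continuous_sumr => i; apply: continuous_exp; exact: coord_continuous.
Qed.

Lemma weight_continuous N : continuous (fun x => (1 + enorm x) ^+ N : R).
Proof.
apply: continuous_exp; apply: continuous_add; last exact: enorm_continuous.
exact: cst_continuous.
Qed.

Lemma weight_ge1 N x : 1 <= (1 + enorm x) ^+ N.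
Proof. by rewrite exprn_ege1// lerDl enorm_ge0. Qed.

End EuclideanNorm.

Section CompactSupport.
Context (R : realType) (n : nat).
Implicit Types (u : 'rV[R]_n -> R[i]) (K : set 'rV[R]_n).

Lemma compact_le_bound K (f : 'rV[R]_n -> R) : compact K -> continuous f ->
  exists2 M : R, 0 < M & forall x, K x -> f x <= M.
Proof.
move=> cK cf.
have [M [_ HM]] := compact_bounded (continuous_compact (continuous_subspaceT cf) cK).
exists (`|M| + 1); first by rewrite ltr_pwDr.
move=> x Kx; apply: le_trans (ler_norm _) _; apply: HM; last by exists x.
by rewrite (le_lt_trans (ler_norm _))// ltrDl.
Qed.

Lemma compact_support_weight u K N : compact K -> continuous u ->
  (forall x, u x != 0 -> K x) ->
  exists2 M : R, 0 < M & forall x, (1 + enorm x) ^+ N * nrm (u x) <= M.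
Proof.
move=> cK cu uK.
have [|M M0 HM] := @compact_le_bound K (fun x => (1 + enorm x) ^+ N * nrm (u x)) cK.
  apply: continuous_mul; first exact: weight_continuous.
  by move=> x; apply: (@continuous_comp _ _ _ u (@nrm R R[i])); [exact: cu|exact: nrm_continuous].
exists M => // x; have [Kx|nKx] := pselect (K x); first exact: HM.
have -> : u x = 0 by apply: contrapT => /eqP/uK.
by rewrite nrm0 mulr0 ltW.
Qed.

(** Heine's theorem on [K]. When only [x + h] lies in [K], the difference is that of the shift by
    [- h] at [x + h], so the same [d] serves. *)
Lemma compact_support_unif_continuous u K (e : R) : compact K -> continuous u ->
  (forall x, u x != 0 -> K x) -> 0 < e ->
  exists2 d : R, 0 < d & forall x h, `|h| < d -> nrm (u (x + h) - u x) < e.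
Proof.
move=> cK cu uK e0.
have H0 x : K x -> \forall x' \near x & h \near (0 : 'rV[R]_n),
    nrm (u (x' + h) - u x') < e.
  move=> Kx.
  have e20 : 0 < e / 2 by rewrite divr_gt0.
  have : nbhs x [set y | nrm (u x - u y) < e / 2].
    exact: ((cvg_nrmP _ _ _).1 (cu x) _ e20).
  move=> /nbhs_normP[d /= d0 dH].
  have d20 : 0 < d / 2 by rewrite divr_gt0.
  have nb (z : 'rV[R]_n) : nbhs z [set y | `|z - y| < d / 2].
    by apply/(@nbhs_normP R 'rV[R]_n z); exists (d / 2).
  exists ([set y | `|x - y| < d / 2], [set h | `|0 - h| < d / 2]).
    by split; exact: nb.
  move=> [y h] /= [xy]; rewrite sub0r normrN => hd.
  have h1 : nrm (u x - u y) < e / 2.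
    by apply: dH => /=; rewrite (lt_trans xy)// ltr_pdivrMr// ltr_pMr// ltr1n.
  have h2 : nrm (u x - u (y + h)) < e / 2.
    apply: dH => /=; rewrite opprD addrA (le_lt_trans (ler_normB _ _))//; lra.
  by have := nrm_tri (u x) (u (y + h)) (u y); rewrite [nrm (_ - u x)]nrmBC; lra.
have := (compact_near_coveringP K).1 cK _ _
  (fun h x => nrm (u (x + h) - u x) < e) _ H0.
move=> /(_ (nbhs_filter _))/(nbhs_normP (0 : 'rV[R]_n))[d /= d0 dH]; exists d => // x h hd.
have hK k y : `|k| < d -> K y -> nrm (u (y + k) - u y) < e.
  by move=> kd Ky; apply: (dH k _ y Ky); rewrite /= sub0r normrN.
have [Kx|nKx] := pselect (K x); first exact: hK.
have u0 : u x = 0 by apply: contrapT => /eqP/uK.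
have [Kx|nKxh] := pselect (K (x + h)).
  by rewrite nrmBC -{1}[x](addrK h); apply: hK; rewrite ?normrN.
have -> : u (x + h) = 0 by apply: contrapT => /eqP/uK.
by rewrite u0 subrr nrm0.
Qed.

(** The complement of the support is open, so vanishing there holds on a neighbourhood and survives
    one more differentiation. *)
Lemma partials_supp (s : seq 'I_n) u x : partials s u x != 0 -> supp u x.
Proof.
elim: s x => [x ux|i s IH x] /=; first exact: (@subset_closure _ [set y | u y != 0] x ux).
rewrite -/(partials s u); apply: contraNP => nsx; apply/eqP.
have /= near0 : \forall y \near x, partials s u y = 0.
  have oC : open_nbhs x (~` supp u).
    by split=> //; apply: closed_openC; exact: closed_closure.
  by apply: filterS (open_nbhs_nbhs oC) => y nsy; apply: contrapT => /eqP/IH.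
have i0 : basis_vec R i != 0.
  apply/eqP => /rowP/(_ i); rewrite !mxE !eqxx/= => /eqP.
  by rewrite oner_eq0.
have D0 (p : R[i] -> R) : p 0 = 0 -> 'D_(basis_vec R i) (p \o partials s u) x = 0.
  move=> p0; rewrite (@near_eq_derive _ _ _ _ (cst 0)) ?derive_cst//.
  by apply: filterS near0 => y /= ->.
by rewrite /partial !D0.
Qed.

End CompactSupport.

Section FiniteOrder.
Context (R : realType) (n : nat).

(** Only finitely many index sequences have length at most [N]; the sum of their constants serves
    them all, and the added 1 makes it positive. *)
Lemma finite_order_bound (P : seq 'I_n -> R -> Prop) :
  (forall s a b, a <= b -> P s a -> P s b) -> (forall s, exists M, P s M) ->
  forall N, exists2 M, 0 < M & forall s, (size s <= N)%N -> P s M.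
Proof.
move=> Pmono /choice[M HM] N.
exists (1 + \sum_(k < N.+1) \sum_(t : k.-tuple 'I_n) `|M t|).
  by rewrite ltr_pwDl// sumr_ge0// => k _; rewrite sumr_ge0.
move=> s sN; apply: Pmono (HM s); rewrite (le_trans (ler_norm _))//.
have h1 : `|M s| <= \sum_(t : (size s).-tuple 'I_n) `|M t|.
  by rewrite (bigD1 (in_tuple s))//= ler_wpDr// sumr_ge0.
rewrite (le_trans h1)// (bigD1 (Ordinal (sN : size s < N.+1)%N))//=.
by rewrite addrCA ler_wpDr// addr_ge0// sumr_ge0// => k _; rewrite sumr_ge0.
Qed.

End FiniteOrder.

Section TestFunctions.
Context (R : realType) (n : nat).
Local Notation D := (test_function R n).
Implicit Types phi psi : D.

Lemma test_smooth phi : smooth phi.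
Proof. by have /test_functionP[] := valP phi. Qed.

Lemma test_compact phi : compact (supp phi).
Proof. by have /test_functionP[] := valP phi. Qed.

Lemma test_partials_weight phi N s : exists2 M : R, 0 < M &
  forall x, (1 + enorm x) ^+ N * nrm (partials s phi x) <= M.
Proof.
apply: (@compact_support_weight _ _ _ _ N (@test_compact phi)).
  exact: (test_smooth phi s).1.
exact: partials_supp.
Qed.

Lemma test_schwartz phi : (phi : 'rV[R]_n -> R[i]) \in @schwartz_pred R n.
Proof.
apply/schwartzP; split=> [|N s]; first exact: test_smooth.
have [M _ HM] := test_partials_weight phi N s; exists M => x.
by rewrite nrmE -rmorphM lecR.
Qed.

Definition schwartz_of_test phi : schwartz R n := Schwartz (test_schwartz phi).

Lemma nbhs_D0 (V : set D) : nbhs (0 : D) V ->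
  exists2 U, zero_nbhs_D U & U `<=` V.
Proof.
move=> [U [oU U0 UV]]; have [W zW WU] := oU _ U0.
by exists W => // x /WU; rewrite add0r; exact: UV.
Qed.

Lemma partials_translateB h phi s : partials s (translate_D h phi - phi : D) =
  translate h (partials s phi) - partials s phi.
Proof.
have -> : (translate_D h phi - phi : D) =
    (-1) *: (phi : 'rV[R]_n -> R[i]) + translate h phi :> ('rV[R]_n -> R[i]).
  by rewrite scaleN1r addrC.
rewrite partials_lin ?partials_translate; first by rewrite scaleN1r addrC.
  exact: test_smooth.
exact/smooth_translate/test_smooth.
Qed.

(** For [|h| < 1] the differences are all supported in one compact set [K], the sum of the support
    and the unit ball. On it only finitely many derivatives must be small, and each is uniformly
    continuous. *)
Lemma translate_D_small phi (U : set D) : zero_nbhs_D U ->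
  exists2 d : R, 0 < d & forall h, `|h| < d -> U (translate_D h phi - phi).
Proof.
move=> [_ zU].
pose B := [set y : 'rV[R]_n | `|y| <= 1].
pose K := (fun p : 'rV[R]_n * 'rV[R]_n => p.1 + p.2) @` (supp phi `*` B).
have cK : compact K.
  apply: continuous_compact; last first.
    apply: compact_setX; first exact: test_compact.
    apply: bounded_closed_compact.
      by exists 1; split => // M M1 x /le_trans; apply; exact: ltW.
    apply: (@preimage_closed _ _ (fun y : 'rV[R]_n => `|y|) [set t | t <= 1]).
      by move=> y _; exact: norm_continuous.
    exact: closed_le.
  by apply: continuous_subspaceT => p; exact: add_continuous.
have [N [e [e0 HU]]] := zU K cK.
have [M M0 HM] : exists2 M : R, 0 < M & forall s, (size s <= N)%N ->
    forall x h, `|h| < M^-1 -> nrm (partials s phi (x + h) - partials s phi x) < e.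
  (* [M] is an inverse radius, which makes [P s] monotone in [M] as [finite_order_bound]
     requires. *)
  pose P s M := forall x h, `|h| * M < 1 ->
    nrm (partials s phi (x + h) - partials s phi x) < e.
  have P1 s a b : a <= b -> P s a -> P s b.
    by move=> ab Pa x h hb; apply: Pa; rewrite (le_lt_trans _ hb)// ler_wpM2l.
  have P2 s : exists M, P s M.
    have [d d0 Hd] := compact_support_unif_continuous (@test_compact phi)
      (test_smooth phi s).1 (@partials_supp _ _ s phi) e0.
    by exists d^-1 => x h; rewrite ltr_pdivrMr// mul1r; exact: Hd.
  have [M M0 HM] := finite_order_bound P1 P2 N.
  by exists M => // s sN x h hM; apply: HM => //; rewrite -ltr_pdivlMr// mul1r.
exists (Num.min 1 M^-1); first by rewrite lt_min ltr01 invr_gt0.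
move=> h; rewrite lt_min => /andP[h1 hM]; apply: HU.
  rewrite [K in _ `<=` K](closure_id K).1; last first.
    by apply: compact_closed => //; exact: norm_hausdorff.
  apply: closureS => x /=.
  have [px|px] := eqVneq (phi x) 0; last first.
    exists (x, 0) => //=; last by rewrite addr0.
    by split; [exact: (@subset_closure _ [set y | phi y != 0])|rewrite /B/= normr0].
  have [pxh|pxh] := eqVneq (phi (x + h)) 0.
    by rewrite -[X in X != 0]/(phi (x + h) - phi x) px pxh subrr eqxx.
  move=> _.
  exists (x + h, - h) => //=; last by rewrite addrK.
  by split; [exact: (@subset_closure _ [set y | phi y != 0])|rewrite /B/= normrN ltW].
move=> s x sN; rewrite partials_translateB nrmE lecR ltW//; exact: HM.
Qed.

(** The growth condition says nothing about small [h]; strong continuity of translations is imported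
    from the test space. *)
Lemma translate_D_cvg (E : normedModType R[i]) (j : {linear D -> E}) phi (e : R) :
  continuous j -> 0 < e -> exists2 d : R, 0 < d &
    forall h, `|h| < d -> nrm (j (translate_D h phi) - j phi) < e.
Proof.
move=> cj e0.
have : nbhs (0 : D) (j @^-1` [set y | nrm (j 0 - y) < e]).
  by apply: (cj 0); apply/nbhs_nrm; exists e.
move=> /nbhs_D0[U zU UV]; have [d d0 Hd] := translate_D_small phi zU.
exists d => // h /Hd/UV /=.
by rewrite linear0 sub0r nrmN linearB.
Qed.

(** Singletons being bounded, strong convergence in the dual implies pointwise convergence, hence
    evaluations are continuous on [E]. *)
Lemma bounded_D1 phi : bounded_D [set phi].
Proof.
move=> V /nbhs_D0[U [_ zU] UV].
have [N [e [e0 HU]]] := zU _ (@test_compact phi).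
pose P s (M : R) := forall x, nrm (partials s phi x) <= M.
have P1 s a b : a <= b -> P s a -> P s b.
  by move=> ab Pa x; exact: le_trans ab.
have P2 s : exists M, P s M.
  have [M _ HM] := test_partials_weight phi 0 s.
  by exists M => x; have := HM x; rewrite expr0 mul1r.
have [M M0 HM] := finite_order_bound P1 P2 N.
exists (M / e); first by rewrite divr_gt0.
move=> a _ aM ->.
have a0 : a != 0.
  by rewrite -normr_gt0 (lt_le_trans _ aM)// ltcR divr_gt0.
exists (a^-1 *: phi); last by rewrite scalerA divff// scale1r.
apply/UV/HU => [|s x sN].
  apply: closureS => x /=; apply: contraNN => /eqP px.
  by rewrite -[(_ *: _) x]/(a^-1 *: phi x) px scaler0.
have -> : partials s (a^-1 *: phi : D) x = a^-1 * partials s phi x.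
  have := @partials_lin R n s a^-1 phi 0 (@test_smooth phi) (@smooth0 R n).
  by rewrite partials0 !addr0 => /(congr1 (fun f => f x)).
rewrite normrM normfV mulrC ler_pdivrMr ?normr_gt0//.
apply: (le_trans (_ : _ <= M%:C)); first by rewrite nrmE lecR; exact: HM.
by move: aM; rewrite -ler_pdivrMl ?ltcR//; rewrite rmorphM/= fmorphV mulrC.
Qed.

End TestFunctions.

(** * Polynomial growth of the translations *)

Section Evaluation.
Context (R : realType) (n : nat) (E : completeNormedModType R[i])
  (iota : {linear E -> distrib R n}).
Local Notation D := (test_function R n).
Implicit Types (g : E) (chi : D).

Lemma iota_evalP (a : R[i]) g h chi :
  iota (a *: g + h) chi = a * iota g chi + iota h chi.
Proof. by rewrite linearP. Qed.

(** Named so that it can carry the structure of a linear form on [E]; these forms separate points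
    and stand in for the dual of [E]. *)
Definition iota_eval chi g : R[i] := iota g chi.

Lemma iota_eval_is_linear chi : linear (iota_eval chi).
Proof. by move=> a g h; exact: iota_evalP. Qed.

HB.instance Definition _ chi := GRing.isLinear.Build R[i] E R[i] *%R
  (iota_eval chi) (iota_eval_is_linear chi).

Lemma iota_eval_continuous chi : continuous iota -> continuous (iota_eval chi).
Proof.
move=> ci g; apply/cvg_nrmP => e e0.
pose U := [set T : distrib R n | nrm (iota g chi - T chi) < e].
have : nbhs (iota g) U.
  exists U; split=> //; last by rewrite /U/= subrr nrm0.
  (* Half of the slack at [T], because [open_D'] uses a non-strict bound and [U] a strict one. *)
  move=> T TU; exists [set chi], ((e - nrm (iota g chi - T chi)) / 2); split.
  - exact: bounded_D1.
  - by rewrite divr_gt0// subr_gt0.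
  - move=> S /(_ chi erefl); rewrite nrmE lecR => H.
    have := nrm_tri (T chi) (iota g chi) (S chi).
    by move: TU; rewrite /U/= [nrm (T chi - S chi)]nrmBC; lra.
by move=> /ci.
Qed.

Lemma eq_iota g h : injective iota -> (forall chi, iota g chi = iota h chi) -> g = h.
Proof. by move=> iinj gh; apply/iinj/val_inj/funext. Qed.

End Evaluation.

Section Translations.
Context (R : realType) (n : nat) (E : completeNormedModType R[i])
  (iota : {linear E -> distrib R n}) (hE : translation_invariant iota).
Local Notation D := (test_function R n).
Implicit Types (g : E) (chi : D) (h : 'rV[R]_n).

Lemma translation_exists : exists Tr : 'rV[R]_n -> E -> E,
  forall h g, is_translate h (iota g) (iota (Tr h g)).
Proof.
have [f Hf] := choice (fun p : 'rV[R]_n * E => translation_closed hE p.1 p.2).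
by exists (fun h g => f (h, g)) => h g; exact: (Hf (h, g)).
Qed.

Lemma translate_unique h g g1 g2 : is_translate h (iota g) (iota g1) ->
  is_translate h (iota g) (iota g2) -> g1 = g2.
Proof.
by move=> h1 h2; apply: (eq_iota (iota_inj hE)) => chi; rewrite h1 h2.
Qed.

Section UniformBound.
Variable Tr : 'rV[R]_n -> E -> E.
Hypothesis TrE : forall h g, is_translate h (iota g) (iota (Tr h g)).

(** [Tr] is only a choice function; linearity holds because both sides are translates of the same
    element. *)
Lemma TrP h (a : R[i]) g g' : Tr h (a *: g + g') = a *: Tr h g + Tr h g'.
Proof.
apply: (@translate_unique h (a *: g + g')) => // chi.
by rewrite !iota_evalP !TrE.
Qed.

Lemma TrD h g g' : Tr h (g + g') = Tr h g + Tr h g'.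
Proof. by have := TrP h 1 g g'; rewrite !scale1r. Qed.

Lemma Tr0 h : Tr h 0 = 0.
Proof. by apply: (@addIr _ (Tr h 0)); rewrite -TrD !add0r. Qed.

Lemma TrZ h (a : R[i]) g : Tr h (a *: g) = a *: Tr h g.
Proof. by have := TrP h a g 0; rewrite Tr0 !addr0. Qed.

Lemma TrB h g g' : Tr h (g - g') = Tr h g - Tr h g'.
Proof. by rewrite TrD -scaleN1r TrZ scaleN1r. Qed.

(** Merging [M] and [tau] into one natural number indexes the growth classes by [nat], as
    [baire_cover] needs. *)
Lemma Tr_growth g : exists k : nat, forall h,
  nrm (Tr h g) <= k%:R * (1 + enorm h) ^+ k.
Proof.
have [M [tau [M0 tau0 H]]] := translation_growth hE g.
pose k := (Num.truncn M + Num.truncn tau).+1.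
have Mk : M <= k%:R.
  by rewrite ltW// (lt_le_trans (truncnS_gt _))// ler_nat ltnS leq_addr.
have tk : tau <= k%:R.
  by rewrite ltW// (lt_le_trans (truncnS_gt _))// ler_nat ltnS leq_addl.
exists k => h; have := H h _ (TrE h g); rewrite nrmE lecR => /le_trans; apply.
rewrite ler_pM ?(ltW M0) ?powR_ge0//.
rewrite -powR_mulrn ?addr_ge0 ?enorm_ge0//; apply: ler_powR => //.
by rewrite lerDl enorm_ge0.
Qed.

(* Baire gives a k such that the elements whose translates grow at most like
   k (1 + |h|) ^ k are dense in a ball; the differences of two of them
   approximate every small u, and summing geometrically better approximations
   gives u itself. *)
Lemma Tr_uniform_bound : exists (C : R) (m : nat), 0 < C /\
  forall h g, nrm (Tr h g) <= C * (1 + enorm h) ^+ m * nrm g.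
Proof.
have [k [x [r [r0 Hr]]]] := baire_cover Tr_growth.
pose w h : R := k%:R * (1 + enorm h) ^+ k.
have w0 h : 0 <= w h by rewrite mulr_ge0 ?exprn_ge0 ?addr_ge0 ?enorm_ge0.
(* Subtracting approximations of [x + u] and of [x] cancels the centre and doubles the growth
   bound. *)
have approx1 u (e : R) : nrm u < r -> 0 < e ->
    exists2 b, nrm (u - b) < e & forall h, nrm (Tr h b) <= 2 * w h.
  move=> ur e0; have e20 : 0 < e / 2 by rewrite divr_gt0.
  have [|b1 B1 xb1] := Hr (x + u) _ _ e20; first by rewrite opprD addNKr nrmN.
  have [|b2 B2 xb2] := Hr x _ _ e20; first by rewrite subrr nrm0.
  exists (b1 - b2).
    have -> : u - (b1 - b2) = (x + u - b1) - (x - b2).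
      by rewrite !opprB -[x + u - b1]addrA [RHS]addrC addrA subrK addrCA.
    by have := nrmB (x + u - b1) (x - b2); lra.
  move=> h; rewrite TrB; have := nrmB (Tr h b1) (Tr h b2).
  by have := B1 h; have := B2 h; rewrite -/(w h); lra.
(* [approx1] for [u] divided by [l]: precision and growth bound both scale with [l]. *)
have approx u (l : R) : 0 < l -> nrm u < r * l ->
    exists2 b, nrm (u - b) < r * (l / 2) & forall h, nrm (Tr h b) <= l * (2 * w h).
  move=> l0 ul.
  have lC : (l^-1)%:C * l%:C = 1 :> R[i] by rewrite -rmorphM mulVf ?gt_eqF// rmorph1.
  have [||b ub Hb] := approx1 (l^-1%:C *: u) (r / 2).
  - by rewrite nrmZr gtr0_norm ?invr_gt0// ltr_pdivrMl// mulrC.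
  - by rewrite divr_gt0.
  exists (l%:C *: b).
    rewrite (_ : u - _ = l%:C *: (l^-1%:C *: u - b)); last first.
      by rewrite scalerBr scalerA mulrC lC scale1r.
    rewrite nrmZr gtr0_norm// mulrCA ltr_pM2l//; lra.
  by move=> h; rewrite TrZ nrmZr gtr0_norm// ler_pM2l.
have small u : nrm u < r -> forall h, nrm (Tr h u) <= 4 * w h.
  move=> ur.
  pose l (j : nat) : R := 2 ^- j.
  have l0 j : 0 < l j by rewrite invr_gt0 exprn_gt0.
  have lS j : l j.+1 = l j / 2 by rewrite /l exprSr invfM.
  have step (p : nat * E) : exists b, nrm p.2 < r * l p.1 ->
      nrm (p.2 - b) < r * l p.1.+1 /\ forall h, nrm (Tr h b) <= l p.1 * (2 * w h).
    have [pr|pr] := ltP (nrm p.2) (r * l p.1); last by exists 0.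
    by have [b b1 b2] := approx p.2 (l p.1) (l0 _) pr; exists b => _; rewrite lS.
  have [f Hf] := choice step.
  (* [v j] is what remains of [u] after [j] approximations. *)
  pose fix v j := if j is i.+1 then v i - f (i, v i) else u.
  have vr j : nrm (v j) < r * l j.
    elim: j => [|j IH] /=; first by rewrite /l expr0 invr1 mulr1.
    by have [] := Hf (j, v j) IH.
  have Trf j h : nrm (Tr h (f (j, v j))) <= l j * (2 * w h).
    by have [_] := Hf (j, v j) (vr j).
  (* Telescoping: the bounds [l p * (2 * w h)] for [p] from [i] to [i + d - 1] form this geometric
     sum. *)
  have TrS h i d : nrm (Tr h (v i) - Tr h (v (i + d)%N)) <= (l i - l (i + d)%N) * (4 * w h).
    elim: d => [|d IH]; first by rewrite addn0 !subrr nrm0 mul0r.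
    have := nrm_tri (Tr h (v (i + d)%N)) (Tr h (v i)) (Tr h (v (i + d.+1)%N)).
    rewrite addnS /= TrB lS opprB [X in _ + nrm X]addrC subrK.
    have := Trf (i + d)%N h; move: IH; lra.
  have lcvg (e : R) : 0 < e -> exists N, forall j, (N <= j)%N -> l j < e.
    move=> e0; have [N HN] := nrm_inv_natP e0; exists N => j Nj.
    apply: le_lt_trans (HN j Nj); rewrite lef_pV2 ?posrE ?exprn_gt0//.
    by rewrite -natrX ler_nat; exact: ltn_expl.
  move=> h.
  have Trd i j : nrm (Tr h (v i) - Tr h (v j)) <= (l i + l j) * (4 * w h).
    have w4 : 0 <= 4 * w h by rewrite mulr_ge0.
    wlog ij : i j / (i <= j)%N.
      move=> H; have [/H//|/ltnW/H] := leqP i j.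
      by rewrite nrmBC [l j + _]addrC.
    have := TrS h i (j - i)%N; rewrite subnKC// => /le_trans; apply.
    by rewrite ler_wpM2r// lerD2l ge0_cp ?ltW.
  have [z Hz] : exists z : E, (fun j => Tr h (v j)) @ \oo --> z.
    apply: complete_nrm => e e0.
    have w4 : 0 < 4 * w h + 1 by rewrite ltr_wpDl// mulr_ge0.
    have [N HN] := lcvg (e / 2 / (4 * w h + 1)) (divr_gt0 (divr_gt0 e0 (ltr0Sn _ _)) w4).
    exists N => i j Ni Nj; apply: le_lt_trans (Trd i j) _.
    have := HN i Ni; have := HN j Nj; rewrite !ltr_pdivlMr// => hj hi.
    have := l0 i; have := l0 j; nra.
  have z0 : z = 0.
    apply: (eq_iota (iota_inj hE)) => chi.
    have c1 := cvg_comp _ _ Hz (@iota_eval_continuous _ _ _ iota chi (iota_continuous hE) z).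
    have v0 : v @ \oo --> (0 : E).
      apply/cvg_nrmP => e e0; have [N HN] := lcvg (e / r) (divr_gt0 e0 r0).
      exists N => // j /= Nj; rewrite sub0r nrmN (lt_trans (vr j))//.
      by rewrite mulrC -ltr_pdivlMr// HN.
    have c2 := cvg_comp _ _ v0 (@iota_eval_continuous _ _ _ iota
      (translate_D (- h) chi) (iota_continuous hE) 0).
    have E12 : iota_eval iota chi \o (fun j => Tr h (v j)) =
       iota_eval iota (translate_D (- h) chi) \o v.
      by apply/funext => j /=; rewrite /iota_eval TrE.
    rewrite E12 in c1.
    have := cvg_unique (@norm_hausdorff _ R[i]) c1 c2; rewrite /iota_eval => ->.
    by rewrite !linear0.
  have tz : nrm (Tr h u - z) <= 4 * w h.
    apply/ler_addgt0Pl => e e0.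
    have [N _ HN] := (cvg_nrmP _ _ _).1 Hz e e0.
    have := HN N (leqnn N) => /= hN.
    have := TrS h 0%N N; rewrite add0n {1}/l expr0 invr1 => t0.
    have := nrm_tri (Tr h (v N)) (Tr h u) z; rewrite [nrm (Tr h (v N) - z)]nrmBC.
    rewrite -[v 0%N]/u in t0.
    have : 0 <= l N * (4 * w h).
      by apply: mulr_ge0; [exact: ltW|apply: mulr_ge0 => //; exact: w0].
    by move: t0 hN; lra.
  by rewrite z0 subr0 in tz.
(* [small] is applied to [g] scaled to norm [r / 2], which turns 4 into [8 / r]; [k.+1] keeps the
   constant positive when [k = 0]. *)
exists (8 * k.+1%:R / r), k; split.
  by rewrite divr_gt0 ?mulr_gt0.
move=> h g; have [->|g0] := eqVneq g 0; first by rewrite Tr0 !nrm0 mulr0.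
have ng : 0 < nrm g by rewrite lt_def nrm_ge0 nrm_eq0 g0.
have := small ((r / (2 * nrm g))%:C *: g) _ h.
have q0 : 0 < r / (2 * nrm g) by rewrite divr_gt0 ?mulr_gt0.
rewrite TrZ !nrmZr gtr0_norm// => H.
have {}H : r / (2 * nrm g) * nrm (Tr h g) <= 4 * w h.
  by apply: H; rewrite invfM mulrA divfK ?gt_eqF// ltr_pdivrMr// ltr_pMr// ltr1n.
rewrite -(ler_pM2l q0) (le_trans H)//.
have -> : r / (2 * nrm g) * (8 * k.+1%:R / r * (1 + enorm h) ^+ k * nrm g) =
    4 * (k.+1%:R * (1 + enorm h) ^+ k).
  by field; rewrite !gt_eqF.
by rewrite ler_pM2l// ler_wpM2r ?exprn_ge0 ?addr_ge0 ?enorm_ge0// ler_nat.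
Qed.

End UniformBound.

End Translations.

(** * Complex and weak vector-valued integrals *)

Section ComplexModulus.
Context (R : realType).
Implicit Types a b z : R[i].

Lemma nrmM a b : nrm (a * b) = nrm a * nrm b.
Proof. exact: (@nrmZ R R[i]). Qed.

Lemma nrmCE z : nrm z = Num.sqrt (complex.Re z ^+ 2 + complex.Im z ^+ 2).
Proof. by rewrite /nrm normc_def. Qed.

Lemma nrm_real (r : R) : nrm (r%:C) = `|r|.
Proof. by rewrite nrmCE/= expr0n addr0 sqrtr_sqr. Qed.

Lemma normr_Re_le z : `|complex.Re z| <= nrm z.
Proof. by rewrite nrmCE -sqrtr_sqr ler_sqrt ?lerDl ?addr_ge0 ?sqr_ge0. Qed.

Lemma normr_Im_le z : `|complex.Im z| <= nrm z.
Proof. by rewrite nrmCE -sqrtr_sqr ler_sqrt ?lerDr ?addr_ge0 ?sqr_ge0. Qed.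

Lemma nrm_le_ReIm z : nrm z <= `|complex.Re z| + `|complex.Im z|.
Proof.
case: z => x y; rewrite (_ : x +i* y = x%:C + 'i%C * y%:C); last by simpc.
rewrite (le_trans (nrmD _ _))//= nrmM !nrm_real; simpc.
by rewrite nrmCE/= expr0n add0r expr1n sqrtr1 mul1r.
Qed.

Lemma ReM a b : complex.Re (a * b) =
  complex.Re a * complex.Re b - complex.Im a * complex.Im b.
Proof. by case: a b => [? ?] [? ?]. Qed.

Lemma ImM a b : complex.Im (a * b) =
  complex.Re a * complex.Im b + complex.Im a * complex.Re b.
Proof. by case: a b => [? ?] [? ?]; simpc. Qed.

Lemma ReD a b : complex.Re (a + b) = complex.Re a + complex.Re b.
Proof. by case: a b => [? ?] [? ?]. Qed.

Lemma ImD a b : complex.Im (a + b) = complex.Im a + complex.Im b.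
Proof. by case: a b => [? ?] [? ?]. Qed.

End ComplexModulus.

Section ComplexIntegral.
Context d (T : measurableType d) (R : realType) (mu : {measure set T -> \bar R}).
Implicit Types f g : T -> R[i].

Definition cmeasurable f :=
  measurable_fun setT (fun t => complex.Re (f t)) /\
  measurable_fun setT (fun t => complex.Im (f t)).

Definition cintegrable f :=
  cmeasurable f /\ mu.-integrable setT (EFin \o (fun t => nrm (f t))).

(** Convertible to [integral_Rn] for [lebesgue_Rn] and functions of the row, so the lemmas below
    apply to it. *)
Definition cint f : R[i] :=
  (\int[mu]_t complex.Re (f t)) +i* (\int[mu]_t complex.Im (f t)).

Definition absint f : R := \int[mu]_t nrm (f t).

Lemma cmeasurable_nrm f : cmeasurable f -> measurable_fun setT (fun t => nrm (f t)).
Proof.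
move=> [mR mI]; under eq_fun do rewrite nrmCE.
have msqrt : measurable_fun setT (Num.sqrt : R -> R).
  by apply: continuous_measurable_fun; exact: sqrt_continuous.
apply: (measurableT_comp msqrt).
by apply: measurable_funD; exact: measurable_funX.
Qed.

Lemma cmeasurable_cst a : cmeasurable (fun=> a).
Proof. by split; exact: measurable_cst. Qed.

Lemma cmeasurableD f g : cmeasurable f -> cmeasurable g ->
  cmeasurable (fun t => f t + g t).
Proof.
move=> [f1 f2] [g1 g2]; split.
  by under eq_fun do rewrite ReD; exact: measurable_funD.
by under eq_fun do rewrite ImD; exact: measurable_funD.
Qed.

Lemma cmeasurableM f g : cmeasurable f -> cmeasurable g ->
  cmeasurable (fun t => f t * g t).
Proof.
move=> [f1 f2] [g1 g2]; split.
  by under eq_fun do rewrite ReM; apply: measurable_funB; exact: measurable_funM.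
by under eq_fun do rewrite ImM; apply: measurable_funD; exact: measurable_funM.
Qed.

Lemma cintegrable_le f g (K : R) : cmeasurable f ->
  (forall t, nrm (f t) <= K * nrm (g t)) -> cintegrable g -> cintegrable f.
Proof.
move=> mf fg [mg ig]; split=> //.
apply: (le_integrable measurableT _ _ (integrableZl measurableT K ig)).
  by apply/measurable_EFinP; exact: cmeasurable_nrm.
move=> t _ /=; rewrite lee_fin ger0_norm ?nrm_ge0//.
by rewrite (le_trans (fg t))// ler_norm.
Qed.

Lemma cintegrable_Re f : cintegrable f ->
  mu.-integrable setT (EFin \o (fun t => complex.Re (f t))).
Proof.
move=> [[mR _] i]; apply: (le_integrable measurableT _ _ i).
  exact/measurable_EFinP.
by move=> t _ /=; rewrite lee_fin [leRHS]ger0_norm ?nrm_ge0// normr_Re_le.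
Qed.

Lemma cintegrable_Im f : cintegrable f ->
  mu.-integrable setT (EFin \o (fun t => complex.Im (f t))).
Proof.
move=> [[_ mI] i]; apply: (le_integrable measurableT _ _ i).
  exact/measurable_EFinP.
by move=> t _ /=; rewrite lee_fin [leRHS]ger0_norm ?nrm_ge0// normr_Im_le.
Qed.

Lemma cintegrableD f g : cintegrable f -> cintegrable g ->
  cintegrable (fun t => f t + g t).
Proof.
move=> [mf intf] [mg intg]; split; first exact: cmeasurableD.
apply: (le_integrable measurableT _ _ (integrableD measurableT intf intg)).
  by apply/measurable_EFinP; exact: cmeasurable_nrm (cmeasurableD mf mg).
move=> t _ /=; rewrite lee_fin ger0_norm ?nrm_ge0// (le_trans (nrmD _ _))//.
exact: ler_norm.
Qed.

Lemma cintegrableZ (a : R[i]) f : cintegrable f -> cintegrable (fun t => a * f t).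
Proof.
move=> intf; apply: (@cintegrable_le _ f (nrm a)) => //.
  by apply: cmeasurableM; [exact: cmeasurable_cst|case: intf].
by move=> t; rewrite nrmM.
Qed.

Lemma cintegrable0 : cintegrable (fun=> 0).
Proof.
split; first exact: cmeasurable_cst.
rewrite (_ : _ \o _ = cst 0%E); first exact: integrable0.
by apply/funext => t /=; rewrite nrm0.
Qed.

Lemma cintegrable_sum (I : Type) (s : seq I) (F : I -> T -> R[i]) :
  (forall i, cintegrable (F i)) -> cintegrable (fun t => \sum_(i <- s) F i t).
Proof.
move=> iF; elim: s => [|i s IH].
  by under eq_fun do rewrite big_nil; exact: cintegrable0.
by under eq_fun do rewrite big_cons; exact: cintegrableD.
Qed.

Lemma cintD f g : cintegrable f -> cintegrable g ->
  cint (fun t => f t + g t) = cint f + cint g.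
Proof.
move=> intf intg; rewrite /cint.
under eq_Rintegral do rewrite ReD; under [X in _ +i* X]eq_Rintegral do rewrite ImD.
rewrite !RintegralD//; first [exact: cintegrable_Re | exact: cintegrable_Im].
Qed.

Lemma cintZ (a : R[i]) f : cintegrable f -> cint (fun t => a * f t) = a * cint f.
Proof.
move=> intf; have iR := cintegrable_Re intf; have iI := cintegrable_Im intf.
have iZ (r : R) (h : T -> R) : mu.-integrable setT (EFin \o h) ->
    mu.-integrable setT (EFin \o (fun t => r * h t)).
  by move=> ih; exact: (integrableZl measurableT r ih).
rewrite /cint; under eq_Rintegral do rewrite ReM.
under [X in _ +i* X]eq_Rintegral do rewrite ImM.
rewrite RintegralB ?RintegralD//; try exact: iZ.
by rewrite !RintegralZl//; case: a => x y; simpc.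
Qed.

Lemma cint0 : cint (fun=> 0) = 0.
Proof. by rewrite /cint !Rintegral_cst// !mul0r. Qed.

Lemma cint_sum (I : Type) (s : seq I) (F : I -> T -> R[i]) :
  (forall i, cintegrable (F i)) ->
  cint (fun t => \sum_(i <- s) F i t) = \sum_(i <- s) cint (F i).
Proof.
move=> iF; elim: s => [|i s IH].
  by rewrite big_nil; under [X in cint X]eq_fun do rewrite big_nil; exact: cint0.
rewrite big_cons -IH -cintD//; last exact: cintegrable_sum.
by congr cint; apply/funext => t; rewrite big_cons.
Qed.

Lemma cintB f g : cintegrable f -> cintegrable g ->
  cint (fun t => f t - g t) = cint f - cint g.
Proof.
move=> intf intg; under [X in cint X]eq_fun do rewrite -mulN1r.
by rewrite cintD//; [rewrite cintZ// mulN1r|exact: cintegrableZ].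
Qed.

Lemma absint_ge0 f : 0 <= absint f.
Proof. by apply: Rintegral_ge0 => t _; exact: nrm_ge0. Qed.

Lemma absint_le f g (K : R) : cintegrable f -> cintegrable g ->
  (forall t, nrm (f t) <= K * nrm (g t)) -> absint f <= K * absint g.
Proof.
move=> [_ intf] [_ intg] fg; rewrite /absint -RintegralZl//.
apply: le_Rintegral => //; exact: (integrableZl measurableT K intg).
Qed.

(** The moduli add up when, as for the pieces of a partition, at most one summand is nonzero at each
    point. *)
Lemma absint_sum (I : Type) (s : seq I) (F : I -> T -> R[i]) f :
  (forall i, cintegrable (F i)) ->
  (forall t, nrm (f t) = \sum_(i <- s) nrm (F i t)) ->
  absint f = \sum_(i <- s) absint (F i).
Proof.
move=> iF fF; rewrite /absint; under eq_Rintegral do rewrite fF.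
elim: s {f fF} => [|i s IH].
  by rewrite big_nil; under eq_Rintegral do rewrite big_nil; rewrite Rintegral_cst// mul0r.
rewrite big_cons -IH; under eq_Rintegral do rewrite big_cons.
rewrite RintegralD//; first by case: (iF i).
elim: s {IH} => [|j s IH].
  rewrite (_ : _ \o _ = cst 0%E); first exact: integrable0.
  by apply/funext => t /=; rewrite big_nil.
have [_ iFj] := iF j.
rewrite (_ : _ \o _ = (EFin \o (fun t => nrm (F j t))) \+
   (EFin \o (fun t => (\sum_(i <- s) nrm (F i t))%R)))%E; last first.
  by apply/funext => t /=; rewrite big_cons EFinD.
exact: integrableD.
Qed.

(** Real and imaginary parts are bounded separately, which costs the factor 2. *)
Lemma nrm_cint_le f : cintegrable f -> nrm (cint f) <= 2 * absint f.
Proof.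
move=> intf; have [_ i] := intf; rewrite (le_trans (nrm_le_ReIm _))//= mulr2n mulrDl mul1r.
have H (h : T -> R) : mu.-integrable setT (EFin \o h) ->
    (forall t, `|h t| <= nrm (f t)) -> `|\int[mu]_t h t| <= absint f.
  move=> ih hf; rewrite (le_trans (le_normr_Rintegral measurableT ih))//.
  by apply: le_Rintegral => //; exact: integrable_norm.
apply: lerD; apply: H; [exact: cintegrable_Re|move=> t; exact: normr_Re_le|
  exact: cintegrable_Im|move=> t; exact: normr_Im_le].
Qed.

End ComplexIntegral.

(** * Integrals of vector-valued step functions *)

Section StepIntegral.
Context d (T : measurableType d) (R : realType) (mu : {measure set T -> \bar R})
  (E : normedModType R[i]).
Variable f : T -> R[i].
Hypothesis intf : cintegrable mu f.

Definition piece (I : eqType) (idx : T -> I) (i : I) (t : T) : R[i] :=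
  f t * (idx t == i)%:R.

Lemma cintegrable_piece (I : finType) (idx : T -> I) i :
  (forall i, measurable (idx @^-1` [set i])) -> cintegrable mu (piece idx i).
Proof.
move=> midx; apply: (@cintegrable_le _ _ _ _ _ f 1) => //; last first.
  move=> t; rewrite mul1r nrmM; case: eqP => _; first by rewrite nrm_real normr1 mulr1.
  by rewrite nrm0 mulr0 nrm_ge0.
apply: cmeasurableM; first by case: intf.
have indE t : ((idx t == i)%:R : R[i]) = (\1_(idx @^-1` [set i]) t)%:C.
  rewrite indicE; case: eqP => [<-|ne]; first by rewrite mem_set.
  by rewrite memNset.
split; under eq_fun do rewrite indE /=; last exact: measurable_cst.
exact: measurable_indic.
Qed.

(** The integral of [f t *: v (idx t)], a finite sum because the vector factor takes finitely many
    values. *)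
Definition step_integral (I : finType) (idx : T -> I) (v : I -> E) : E :=
  \sum_i cint mu (piece idx i) *: v i.

Lemma step_integral_norm_le (I : finType) (idx : T -> I) (v : I -> E) (K : R) :
  (forall i, measurable (idx @^-1` [set i])) ->
  (forall t, nrm (v (idx t)) <= K) ->
  nrm (step_integral idx v) <= 2 * K * absint mu f.
Proof.
move=> midx vK; rewrite (le_trans (nrm_sum _ _))//.
have -> : absint mu f = \sum_i absint mu (piece idx i).
  apply: absint_sum => [i|t]; first exact: cintegrable_piece.
  rewrite (bigD1 (idx t))//= big1 => [|i it]; rewrite /piece ?eqxx ?mulr1 ?addr0//.
  by rewrite eq_sym (negbTE it) mulr0 nrm0.
rewrite mulr_sumr; apply: ler_sum => i _; rewrite nrmZ.
(* [K] bounds only attained values of [v]; the piece of an unattained index is zero. *)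
have [[t ti]|nt] := pselect (exists t, idx t = i).
  apply: (@le_trans _ _ (2 * absint mu (piece idx i) * nrm (v i))).
    rewrite ler_wpM2r ?nrm_ge0//.
    by apply: nrm_cint_le; exact: cintegrable_piece.
  by rewrite mulrAC ler_wpM2r ?absint_ge0// ler_wpM2l// -ti.
have p0 : piece idx i = fun=> 0.
  apply/funext => t; rewrite /piece; case: eqP => [ti|_]; last by rewrite mulr0.
  by case: nt; exists t.
rewrite p0 cint0 normr0 mul0r.
have -> : absint mu (fun=> 0 : R[i]) = 0.
  by rewrite /absint; under eq_Rintegral do rewrite nrm0; rewrite Rintegral_cst// mul0r.
by rewrite mulr0.
Qed.

(** Passing to the common refinement of two partitions lets two step integrals be subtracted term by
    term. *)
Lemma step_integral_fst (I J : finType) (idx : T -> I) (idy : T -> J) (v : I -> E) :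
  (forall i, measurable (idx @^-1` [set i])) ->
  (forall j, measurable (idy @^-1` [set j])) ->
  step_integral idx v = step_integral (fun t => (idx t, idy t)) (v \o fst).
Proof.
move=> mx my; rewrite /step_integral.
rewrite -(pair_bigA _ (fun i j => cint mu (piece (fun t => (idx t, idy t)) (i, j)) *: v i))/=.
apply: eq_bigr => i _; rewrite -scaler_suml -cint_sum; last first.
  move=> j; apply: cintegrable_piece => -[i' j'].
  rewrite (_ : _ @^-1` _ = (idx @^-1` [set i']) `&` (idy @^-1` [set j'])).
    exact: measurableI.
  by apply/seteqP; split => t /= [-> ->].
congr (_ *: _); congr cint; apply/funext => t; rewrite /piece -mulr_sumr.
congr (_ * _); rewrite (bigD1 (idy t))//= big1 => [|j jt].
  by rewrite xpair_eqE eqxx andbT addr0.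
by rewrite xpair_eqE [idy t == j]eq_sym (negbTE jt) andbF.
Qed.

Lemma step_integral_snd (I J : finType) (idx : T -> I) (idy : T -> J) (v : J -> E) :
  (forall i, measurable (idx @^-1` [set i])) ->
  (forall j, measurable (idy @^-1` [set j])) ->
  step_integral idy v = step_integral (fun t => (idx t, idy t)) (v \o snd).
Proof.
move=> mx my; rewrite (step_integral_fst v my mx) /step_integral.
rewrite (reindex (fun p : I * J => (p.2, p.1)))/=; last first.
  by apply: onW_bij; exists (fun p : J * I => (p.2, p.1)) => -[].
apply: eq_bigr => -[i j] _ /=; congr (_ *: _); congr cint; apply/funext => t.
by rewrite /piece !xpair_eqE andbC.
Qed.

Lemma step_integral_dist_le (I J : finType) (idx : T -> I) (idy : T -> J)
    (v : I -> E) (w : J -> E) (K : R) :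
  (forall i, measurable (idx @^-1` [set i])) ->
  (forall j, measurable (idy @^-1` [set j])) ->
  (forall t, nrm (v (idx t) - w (idy t)) <= K) ->
  nrm (step_integral idx v - step_integral idy w) <= 2 * K * absint mu f.
Proof.
move=> mx my vw; rewrite (step_integral_fst v mx my) (step_integral_snd w mx my).
rewrite -sumrB; under eq_bigr do rewrite -scalerBr.
apply: (@step_integral_norm_le _ _ (fun p => v p.1 - w p.2)) => // -[i j].
rewrite (_ : _ @^-1` _ = (idx @^-1` [set i]) `&` (idy @^-1` [set j])).
  exact: measurableI.
by apply/seteqP; split => t /= [-> ->].
Qed.

Lemma step_integral_linear (I : finType) (idx : T -> I) (v : I -> E)
    (l : {linear E -> R[i]}) : (forall i, measurable (idx @^-1` [set i])) ->
  l (step_integral idx v) = cint mu (fun t => f t * l (v (idx t))) /\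
  cintegrable mu (fun t => f t * l (v (idx t))).
Proof.
move=> mx.
have -> : (fun t => f t * l (v (idx t))) =
    fun t => \sum_i l (v i) * piece idx i t.
  apply/funext => t; rewrite (bigD1 (idx t))//= big1 => [|i it].
    by rewrite /piece eqxx mulr1 addr0 mulrC.
  by rewrite /piece eq_sym (negbTE it) !mulr0.
have ip i : cintegrable mu (fun t => l (v i) * piece idx i t).
  by apply: cintegrableZ; exact: cintegrable_piece.
split; last exact: cintegrable_sum.
rewrite cint_sum// linear_sum; apply: eq_bigr => i _.
rewrite cintZ; last exact: cintegrable_piece.
rewrite mulrC; exact: linearZ.
Qed.

End StepIntegral.

Section WeakIntegral.
Context d (T : measurableType d) (R : realType) (mu : {measure set T -> \bar R})
  (E : completeNormedModType R[i]) (J : Type) (l : J -> {linear E -> R[i]}).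

(* No vector-valued integral is needed: step functions close to G have
   integrals that form a Cauchy sequence in E, and testing with the l j shows
   that its limit is e. *)
Lemma weak_integral_norm_le (f : T -> R[i]) (G : T -> E) (K : R) (e : E) :
  cintegrable mu f -> (forall t, nrm (G t) <= K) ->
  (forall eta : R, 0 < eta -> exists (k : nat) (idx : T -> 'I_k) (v : 'I_k -> E),
    (forall i, measurable (idx @^-1` [set i])) /\
    forall t, nrm (G t - v (idx t)) < eta) ->
  (forall j, continuous (l j)) -> (forall x y, (forall j, l j x = l j y) -> x = y) ->
  (forall j, cintegrable mu (fun t => f t * l j (G t))) ->
  (forall j, l j e = cint mu (fun t => f t * l j (G t))) ->
  nrm e <= 2 * K * absint mu f.
Proof.
move=> intf GK appr cl sep intl le.
(* The number of values varies with [m], hence the dependent pair handed to [choice]. *)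
have step (m : nat) : exists p : {k & ((T -> 'I_k) * ('I_k -> E))%type},
    (forall i, measurable ((projT2 p).1 @^-1` [set i])) /\
    forall t, nrm (G t - (projT2 p).2 ((projT2 p).1 t)) < m.+1%:R^-1.
  have [|k [idx [v H]]] := appr m.+1%:R^-1; first by [].
  by exists (existT _ k (idx, v)).
have [p H] := choice step.
pose idx m := (projT2 (p m)).1; pose v m := (projT2 (p m)).2.
pose S m := step_integral mu f (idx m) (v m).
have A0 := absint_ge0 mu f.
(* The 4 is the factor 2 of [step_integral_dist_le] times two errors [eta]. *)
have small (r : R) : 0 < r -> exists2 eta : R, 0 < eta & eta * (4 * absint mu f) < r.
  move=> r0; have q0 : 0 < 4 * absint mu f + 1 by rewrite ltr_wpDl// mulr_ge0.
  exists (r / (4 * absint mu f + 1)); first by rewrite divr_gt0.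
  by rewrite mulrAC ltr_pdivrMr// ltr_pM2l// ltrDl.
have [s Ss] : exists s : E, S @ \oo --> s.
  apply: complete_nrm => r r0; have [eta eta0 Heta] := small r r0.
  have [N HN] := nrm_inv_natP eta0; exists N => m q Nm Nq.
  apply: le_lt_trans Heta; rewrite mulrA [eta * 4]mulrC.
  rewrite (_ : 4 * eta = 2 * (eta + eta)); last by ring.
  apply: step_integral_dist_le => // [i|j|t].
  - exact: (H m).1.
  - exact: (H q).1.
  - have := (H m).2 t; have := (H q).2 t; have := HN m Nm; have := HN q Nq.
    rewrite -/(idx m) -/(idx q) -/(v m) -/(v q).
    move: (_.+1%:R^-1) (_.+1%:R^-1) => x y.
    have := nrm_tri (G t) (v m (idx m t)) (v q (idx q t)).
    by rewrite [nrm (v m _ - G t)]nrmBC; lra.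
(* The numbers [l j (S m)] tend to [l j s] by continuity and to [l j e] by the scalar estimate
   [nrm_cint_le]. *)
have -> : e = s.
  apply: sep => j; rewrite le; apply/esym.
  apply: (@cvg_unique _ (@norm_hausdorff _ R[i]) (l j \o S @ \oo) _).
    exact: (cvg_comp _ _ Ss (cl j s)).
  apply/cvg_nrmP => r r0; have [eta eta0 Heta] := small r r0.
  have : nbhs (0 : E) [set x | nrm (l j 0 - l j x) < eta].
    exact: ((cvg_nrmP _ _ (nbhs_filter _)).1 (cl j 0) eta eta0).
  rewrite linear0 => /nbhs_nrm[dl dl0 Hdl].
  have [N HN] := nrm_inv_natP dl0; exists N => // m /= Nm.
  have [-> ist] := step_integral_linear intf (v m) (l j) (H m).1.
  rewrite -cintB//; have idiff := cintegrableD (intl j) (cintegrableZ (-1) ist).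
  have diffE : (fun t => f t * l j (G t) + -1 * (f t * l j (v m (idx m t)))) =
      fun t => f t * l j (G t) - f t * l j (v m (idx m t)).
    by apply/funext => t; rewrite mulN1r.
  rewrite diffE in idiff.
  apply: le_lt_trans Heta; rewrite (le_trans (nrm_cint_le idiff))//.
  have -> : eta * (4 * absint mu f) = 2 * (eta * absint mu f) + 2 * (eta * absint mu f) by ring.
  rewrite ler_wpDr ?mulr_ge0 ?(ltW eta0)// ler_wpM2l//.
  apply: absint_le => // t; rewrite -mulrBr nrmM mulrC ler_wpM2r ?nrm_ge0//.
  rewrite -linearB -nrmN -[X in nrm X]add0r ltW//; apply: Hdl.
  by rewrite sub0r nrmN (lt_trans ((H m).2 t))// HN.
have SK m : nrm (S m) <= 2 * (K + m.+1%:R^-1) * absint mu f.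
  apply: step_integral_norm_le => [//|i|t]; first exact: (H m).1.
  have := (H m).2 t; rewrite -/(idx m) -/(v m); move: (_.+1%:R^-1) => x Ht.
  have := nrm_tri (G t) (v m (idx m t)) 0; rewrite !subr0 nrmBC.
  by have := GK t; lra.
apply/ler_addgt0Pl => r r0.
have r20 : 0 < r / 2 by rewrite divr_gt0.
have [eta eta0 Heta] := small _ r20.
have [N HN] := nrm_inv_natP eta0.
have [M _ HM] := (cvg_nrmP _ _ _).1 Ss _ r20.
pose m := maxn N M.
have h1 := HM m (leq_maxr _ _); have h2 := HN m (leq_maxl _ _); have h3 := SK m.
rewrite /= in h1.
have h5 : m.+1%:R^-1 * absint mu f <= eta * absint mu f by rewrite ler_wpM2r// ltW.
have h6 : 0 <= eta * absint mu f by rewrite mulr_ge0// ltW.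
have h8 : nrm s <= nrm (s - S m) + nrm (S m) by have := nrmD (s - S m) (S m); rewrite subrK.
move: h1 h3 h5 h6 h8 Heta; rewrite mulrDr mulrDl; move: (m.+1%:R^-1) => x; nra.
Qed.

End WeakIntegral.

(** * Integration over R^n *)

Section ReImContinuous.
Context (R : realType).

Lemma Re_continuous : continuous (@complex.Re R : R[i] -> R).
Proof.
move=> z; apply/(@cvgrPdist_lt R R _ (nbhs z) (nbhs_filter z)) => e e0.
have : nbhs z [set y | nrm (z - y) < e] by apply/nbhs_nrm; exists e.
apply: filterS => -[a b]; case: z => c d /=.
by apply: le_lt_trans; exact: (@normr_Re_le R ((c +i* d) - (a +i* b))).
Qed.

Lemma Im_continuous : continuous (@complex.Im R : R[i] -> R).
Proof.
move=> z; apply/(@cvgrPdist_lt R R _ (nbhs z) (nbhs_filter z)) => e e0.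
have : nbhs z [set y | nrm (z - y) < e] by apply/nbhs_nrm; exists e.
apply: filterS => -[a b]; case: z => c d /=.
by apply: le_lt_trans; exact: (@normr_Im_le R ((c +i* d) - (a +i* b))).
Qed.

End ReImContinuous.

Section CountableFactor.
Context d (T : measurableType d) (C : countType) (g : T -> C).

(** Every preimage is a countable union of fibres of [g]. *)
Lemma measurable_countable_comp d' (T' : measurableType d') (f : C -> T') :
  (forall c, measurable (g @^-1` [set c])) -> measurable_fun setT (f \o g).
Proof.
move=> mg _ Y mY; rewrite setTI.
rewrite (_ : _ @^-1` _ = \bigcup_c (if f c \in Y then g @^-1` [set c] else set0)).
  apply: countable_bigcupT_measurable; first exact: countableP.
  by move=> c; case: ifP.
apply/seteqP; split => [t /= Yt|t [c _]].
  by exists (g t) => //; rewrite mem_set.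
by case: ifPn => // /set_mem Yc /= ->.
Qed.

End CountableFactor.

(* The sigma-algebra on tuples is the product one and row vectors carry only a
   topology, so a continuous function of the row is made measurable as the
   limit of its values at the corners of the grid cells of side 1/(m+1). *)
Section MeasurableRow.
Context (R : realType) (n : nat).
Local Notation RT := (measurableTypeR R).
Local Notation row := (@row_of_tuple R n).

Let cell (m : nat) (t : n.-tuple RT) : {ffun 'I_n -> int} :=
  [ffun i => Num.floor (m.+1%:R * (tnth t i : R))].

Let corner (m : nat) (c : {ffun 'I_n -> int}) : 'rV[R]_n :=
  \row_i ((c i)%:~R / m.+1%:R).

Let measurable_cell m c : measurable (cell m @^-1` [set c]).
Proof.
rewrite (_ : _ @^-1` _ = \big[setI/setT]_(i < n)
    ((fun t : n.-tuple RT => m.+1%:R * (tnth t i : R)) @^-1` `[(c i)%:~R, (c i + 1)%:~R[)).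
  apply: bigsetI_measurable => i _; rewrite -[X in measurable X]setTI.
  have mi : measurable_fun setT (fun t : n.-tuple RT => m.+1%:R * (tnth t i : R)).
    by apply: measurable_funM => //; exact: measurable_tnth.
  by apply: mi => //; exact: measurable_itv.
apply/seteqP; split => [t /= <-|t].
  by rewrite -bigcap_seq => i _ /=; rewrite in_itv/= ffunE; exact: floor_itv.
rewrite -bigcap_seq => H; apply/ffunP => i; rewrite ffunE.
have /= := H i (mem_index_enum i); rewrite in_itv/= => Hi.
by apply: floor_def.
Qed.

Let corner_cell m t : `|corner m (cell m t) - row t| <= m.+1%:R^-1.
Proof.
rewrite -[`|_|]/(mx_norm _) mx_normrE; apply/bigmax_leP; split.
  by rewrite invr_ge0.
move=> [i j] _ /=; rewrite !mxE ffunE.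
have /andP[h1 h2] := floor_itv (m.+1%:R * (tnth t j : R)).
have m0 : 0 < m.+1%:R :> R by [].
rewrite intrD in h2.
rewrite -(ler_pM2l m0) mulfV ?gt_eqF// -{1}(gtr0_norm m0) -normrM.
rewrite mulrBr mulrC divfK ?gt_eqF// ler_norml; apply/andP; split; lra.
Qed.

Lemma measurable_row (u : 'rV[R]_n -> R) : continuous u ->
  measurable_fun setT (fun t : n.-tuple RT => u (row t)).
Proof.
move=> cu; apply: (measurable_fun_cvg (h := fun m t => u (corner m (cell m t)))).
  move=> m; exact: (measurable_countable_comp (u \o corner m) (measurable_cell m)).
move=> t _; apply: (cvg_comp (fun m => corner m (cell m t)) u _ (cu (row t))).
apply/cvgrPdist_lt => e e0; have [N HN] := nrm_inv_natP e0.
exists N => // m /= Nm; rewrite distrC (le_lt_trans (corner_cell m t))//.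
exact: HN.
Qed.

Lemma cmeasurable_row (u : 'rV[R]_n -> R[i]) : continuous u ->
  cmeasurable (fun t : n.-tuple RT => u (row t)).
Proof.
move=> cu; split; apply: (measurable_row (u := fun x => _ (u x))) => x.
  exact: (continuous_comp (cu x) (@Re_continuous R (u x))).
exact: (continuous_comp (cu x) (@Im_continuous R (u x))).
Qed.

End MeasurableRow.

(** * Affine changes of variables *)

Section AffineChangeOfVariables.
Context (R : realType).
Local Notation RT := (measurableTypeR R).
Local Open Scope ereal_scope.

(** By uniqueness of Lebesgue measure it suffices that [|a|] times the pushforward agrees with it on
    half-open intervals. *)
Lemma lebesgue_affine (x a : R) (f : RT -> \bar R) : (a != 0)%R ->
  measurable_fun setT f -> (forall t, 0 <= f t) ->
  \int[lebesgue_measure]_t f t =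
  `|a|%:E * \int[lebesgue_measure]_t f (x + a * t)%R.
Proof.
move=> a0 mf f0; pose aff : RT -> RT := fun t => (x + a * t)%R.
have maff : measurable_fun setT aff.
  by apply: measurable_funD => //; exact: measurable_funM.
have na0 : (0 < `|a|)%R by rewrite normr_gt0.
have [pf pfE] : exists pf : {measure set RT -> \bar R},
    pf = pushforward (@lebesgue_measure R) aff :> (set RT -> \bar R).
  by unshelve eexists (pushforward (@lebesgue_measure R) aff).
pose m := mscale (NngNum (ltW na0)) pf.
have mE A : measurable A -> lebesgue_measure A = m A.
  apply: lebesgue_measure_unique => _ [[p q] _ <-].
  suff : lebesgue_measure `]p, q]%classic = `|a|%:E * pf `]p, q]%classic by [].
  rewrite pfE /pushforward.
  have affE t : aff t = (x + a * t)%R by [].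
  (* A negative [a] swaps the endpoints, so the preimage is half-open on the other side; its length
     is unaffected. *)
  have [a_lt0|a_gt0] := ltrP a 0.
    rewrite (_ : aff @^-1` _ = `[((q - x) / a)%R, ((p - x) / a)%R[%classic); last first.
      apply/seteqP; split => t /=; rewrite !in_itv/= affE ler_ndivrMr// ltr_ndivlMr//;
        by rewrite mulrC => /andP[? ?]; apply/andP; split; lra.
    rewrite !lebesgue_measure_itv/= !lte_fin ltr_nM2r ?invr_lt0// ltrD2r.
    case: ifPn => _; last by rewrite mule0.
    rewrite -!EFinB -EFinM; congr EFin; rewrite ltr0_norm//; field.
    by rewrite lt_eqF.
  have {}a_gt0 : (0 < a)%R by rewrite lt_def a0.
  rewrite (_ : aff @^-1` _ = `]((p - x) / a)%R, ((q - x) / a)%R]%classic); last first.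
    apply/seteqP; split => t /=; rewrite !in_itv/= affE ler_pdivlMr// ltr_pdivrMr//;
      by rewrite mulrC => /andP[? ?]; apply/andP; split; lra.
  rewrite !lebesgue_measure_itv/= !lte_fin ltr_pM2r ?invr_gt0// ltrD2r.
  case: ifPn => _; last by rewrite mule0.
  rewrite -!EFinB -EFinM; congr EFin; rewrite gtr0_norm//; field.
  by rewrite gt_eqF.
rewrite (eq_measure_integral m); last by move=> A mA _; exact: mE.
rewrite ge0_integral_mscale//; congr (_ * _).
rewrite (eq_measure_integral (pushforward (@lebesgue_measure R) aff)); last first.
  by move=> A mA _; rewrite pfE.
by rewrite ge0_integral_pushforward.
Qed.

Definition affine_tuple n (x : n.-tuple RT) (a : R) (t : n.-tuple RT) : n.-tuple RT :=
  [tuple (tnth x i + a * tnth t i)%R | i < n].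

Lemma measurable_affine_tuple n (x : n.-tuple RT) (a : R) :
  measurable_fun setT (affine_tuple x a).
Proof.
apply/measurable_fun_tnthP => i.
rewrite (_ : _ \o _ = fun t => (tnth x i + a * tnth t i)%R).
  by apply: measurable_funD => //; apply: measurable_funM => //; exact: measurable_tnth.
by apply/funext => t /=; rewrite tnth_mktuple.
Qed.

Lemma affine_tuple_cons n (x : n.+1.-tuple RT) (a : R) p :
  affine_tuple x a (tuple_cons p) =
  tuple_cons ((thead x + a * p.1)%R, affine_tuple [tuple of behead x] a p.2).
Proof.
apply: eq_from_tnth => i; rewrite tnth_mktuple.
case: (unliftP ord0 i) => [j|] ->; last by rewrite -[RHS]/(thead x + a * p.1)%R.
by rewrite /tuple_cons !tnthS tnth_mktuple !tnth_behead; congr (tnth x _ + _)%R;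
  apply/val_inj; rewrite /= inordK// ltnS ltn_ord.
Qed.

(** Tonelli along the first coordinate, matching the recursion of [lebesgue_Rn]; it drives the
    inductions on [n]. *)
Lemma ge0_integral_lebesgue_cons n (f : n.+1.-tuple RT -> \bar R) :
  measurable_fun setT f -> (forall t, 0 <= f t) ->
  \int[lebesgue_Rn R n.+1]_t f t =
  \int[lebesgue_measure]_s \int[lebesgue_Rn R n]_t f (tuple_cons (s, t)).
Proof.
move=> mf f0; have mc := @measurable_tuple_cons R n.
rewrite [LHS](_ : _ = \int[pushforward (@lebesgue_measure R \x lebesgue_Rn R n) (@tuple_cons R n)]_t f t)//.
rewrite ge0_integral_pushforward// preimage_setT.
rewrite (fubini_tonelli1 (m1 := @lebesgue_measure R) (f \o @tuple_cons R n))//.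
  exact: measurableT_comp.
by move=> p; exact: f0.
Qed.

Lemma ge0_integral_affine n (x : n.-tuple RT) (a : R) (f : n.-tuple RT -> \bar R) :
  (a != 0)%R -> measurable_fun setT f -> (forall t, 0 <= f t) ->
  \int[lebesgue_Rn R n]_t f t =
  (`|a| ^+ n)%:E * \int[lebesgue_Rn R n]_t f (affine_tuple x a t).
Proof.
move=> a0; elim: n x f => [|n IH] x f mf f0.
  rewrite expr0 mul1e; apply: eq_integral => t _.
  by rewrite (tuple0 t) (tuple0 (affine_tuple _ _ _)).
have mc := @measurable_tuple_cons R n.
rewrite !ge0_integral_lebesgue_cons//; last first.
  by apply: measurableT_comp => //; exact: measurable_affine_tuple.
pose x' : n.-tuple RT := [tuple of behead x].
pose h := fun s => \int[lebesgue_Rn R n]_t f (tuple_cons (s, affine_tuple x' a t)).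
have mh : measurable_fun setT h.
  apply: (@measurable_fun_fubini_tonelli_F _ _ _ _ _ _
   (fun p => f (tuple_cons (p.1, affine_tuple x' a p.2)))) => //.
  apply: measurableT_comp => //; apply: measurableT_comp => //.
  apply/measurable_fun_pairP; split; first exact: measurable_fst.
  exact: (measurableT_comp (measurable_affine_tuple x' a) measurable_snd).
have h0 s : 0 <= h s by apply: integral_ge0.
transitivity (\int[lebesgue_measure]_s ((`|a| ^+ n)%:E * h s)).
  apply: eq_integral => s _; rewrite (IH x')//.
  have ms : measurable_fun setT (fun t : n.-tuple RT => (s, t)).
    exact: pair1_measurable.
  exact: (measurableT_comp mf (measurableT_comp mc ms)).
rewrite ge0_integralZl//.
rewrite (lebesgue_affine (thead x) a0 mh h0) muleA -EFinM -exprSr.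
congr (_ * _); apply: eq_integral => s _; apply: eq_integral => t _.
by rewrite affine_tuple_cons.
Qed.

(** With [pfineM], a positive factor respects the conventions for infinite values, so
    [Rintegral_affine] can rest on measurability alone. *)
Lemma pmuleBr (r : R) (A B : \bar R) : (0 < r)%R ->
  r%:E * (A - B) = r%:E * A - r%:E * B.
Proof.
move=> r0; case: A B => [A||] [B||] /=;
  rewrite ?(gt0_muley, gt0_muleNy) ?lte_fin//=.
by rewrite -EFinD -!EFinM -EFinD mulrBr.
Qed.

Lemma pfineM (r : R) (A : \bar R) : (0 < r)%R -> fine (r%:E * A) = (r * fine A)%R.
Proof.
move=> r0; case: A => [A||] //=; rewrite ?(gt0_muley, gt0_muleNy) ?lte_fin//=;
  by rewrite mulr0.
Qed.

Lemma Rintegral_affine n (x : n.-tuple RT) (a : R) (f : n.-tuple RT -> R) :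
  (a != 0)%R -> measurable_fun setT f ->
  (\int[lebesgue_Rn R n]_t f t =
  `|a| ^+ n * \int[lebesgue_Rn R n]_t f (affine_tuple x a t))%R.
Proof.
move=> a0 mf; have an0 : (0 < `|a| ^+ n)%R by rewrite exprn_gt0// normr_gt0.
have mef : measurable_fun setT (EFin \o f) by exact/measurable_EFinP.
rewrite /Rintegral integralE.
rewrite (ge0_integral_affine x a0 (measurable_funepos mef))//.
rewrite (ge0_integral_affine x a0 (measurable_funeneg mef))//.
rewrite -pmuleBr// pfineM//; congr (_ * fine _)%R.
rewrite [RHS]integralE; congr (_ - _); apply: eq_integral => t _.
  exact: (esym (congr1 (fun h => h t) (funepos_comp (EFin \o f) (affine_tuple x a)))).
exact: (esym (congr1 (fun h => h t) (funeneg_comp (EFin \o f) (affine_tuple x a)))).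
Qed.

(** Applied with [a = - eps] to rescaled convolutions and with [a = 1] to translations. *)
Lemma integral_Rn_affine n (x : 'rV[R]_n) (a : R) (u : 'rV[R]_n -> R[i]) :
  (a != 0)%R -> continuous u ->
  (integral_Rn u = (`|a| ^+ n)%:C%C * integral_Rn (fun y => u (x + a *: y)))%R.
Proof.
move=> a0 cu; have [mR mI] := cmeasurable_row cu.
pose tx : n.-tuple RT := [tuple x ord0 i | i < n].
have rowE t : row_of_tuple (affine_tuple tx a t) = (x + a *: row_of_tuple t)%R.
  by apply/rowP => i; rewrite !mxE !tnth_mktuple.
rewrite /integral_Rn (Rintegral_affine tx a0 mR) (Rintegral_affine tx a0 mI).
have HE (p : R[i] -> R) : (\int[lebesgue_Rn R n]_t p (u (row_of_tuple (affine_tuple tx a t))) =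
    \int[lebesgue_Rn R n]_t p (u (x + a *: row_of_tuple t)))%R.
  by apply: eq_Rintegral => t _; rewrite rowE.
rewrite (HE (@complex.Re R)) (HE (@complex.Im R)).
by apply/eqP; rewrite eq_complex/= !mul0r subr0 addr0 !eqxx.
Qed.

End AffineChangeOfVariables.

(** * Integrability from polynomial decay *)

Section Decay.
Context (R : realType).
Local Notation RT := (measurableTypeR R).

Let q (t : R) : R := (oneDsqr t)^-1.

Let q_ge0 t : 0 <= q t.
Proof. by rewrite invr_ge0 (le_trans ler01)// oneDsqr_ge1. Qed.

Let mq : measurable_fun setT (q : RT -> R).
Proof. by apply: continuous_measurable_fun; exact: continuous_oneDsqrV. Qed.

(** By evenness the negative half-line contributes at most the known integral over the positive
    one. *)
Lemma integral_oneDsqrV_lty : (\int[@lebesgue_measure R]_t (q t)%:E < +oo)%E.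
Proof.
have meq : measurable_fun setT (EFin \o q) by exact/measurable_EFinP.
have half : (\int[@lebesgue_measure R]_(t in `[0%R, +oo[) (q t)%:E < +oo)%E.
  by rewrite integral0y_oneDsqr ltry.
rewrite -(setUv `[0%R, +oo[%classic) ge0_integral_setU//; last 4 first.
- exact: measurableC.
- by rewrite setUv.
- by move=> t _; rewrite lee_fin.
- by apply/disj_setPS; rewrite setICr.
apply: lte_add_pinfty => //; apply: le_lt_trans half.
have -> : (\int[@lebesgue_measure R]_(t in `[0%R, +oo[) (q t)%:E =
    \int[@lebesgue_measure R]_(t in `]-oo, 0%R]) (q t)%:E)%E.
  rewrite (ge0_integration_by_substitution0 meq) => [|t]; last by rewrite lee_fin.
  by apply: eq_integral => t _; rewrite /= /q /oneDsqr sqrrN.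
apply: ge0_subset_integral => //.
- exact: measurableC.
- exact: measurable_funTS.
- by move=> t _; rewrite lee_fin.
- by move=> t /=; rewrite !in_itv/= andbT => /negP; rewrite -ltNge => /ltW.
Qed.

Let Q n (t : n.-tuple RT) : R := \prod_(i < n) q (tnth t i).

Let Q_ge0 n (t : n.-tuple RT) : 0 <= Q t.
Proof. exact: prodr_ge0. Qed.

Let mQ n : measurable_fun setT (@Q n).
Proof.
apply: measurable_prod => i _.
exact: (measurableT_comp mq (measurable_tnth i)).
Qed.

Lemma integral_prod_oneDsqrV_lty n : (\int[lebesgue_Rn R n]_t (Q t)%:E < +oo)%E.
Proof.
elim: n => [|n IH].
  rewrite (eq_integral (cst 1%E)); last by move=> t _; rewrite /Q big_ord0.
  by rewrite integral_cst// mul1e /= diracT ltry.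
have mEQ k : measurable_fun setT (fun t : k.-tuple RT => (Q t)%:E).
  by apply/measurable_EFinP; exact: mQ.
rewrite ge0_integral_lebesgue_cons//; last by move=> t; rewrite lee_fin.
have QS s t : Q (tuple_cons (s, t)) = q s * Q t :> R.
  by rewrite /Q big_ord_recl; congr (_ * _); apply: eq_bigr => i _; rewrite /tuple_cons tnthS.
have -> : (\int[@lebesgue_measure R]_s \int[lebesgue_Rn R n]_t (Q (tuple_cons (s, t)))%:E =
    \int[@lebesgue_measure R]_s ((q s)%:E * \int[lebesgue_Rn R n]_t (Q t)%:E))%E.
  apply: eq_integral.
  move=> s _; under eq_integral do rewrite QS EFinM.
  by rewrite ge0_integralZl//; [exact: mEQ|move=> t _; rewrite lee_fin|rewrite lee_fin].
rewrite ge0_integralZr//; last 3 first.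
- exact/measurable_EFinP.
- by move=> t _; rewrite lee_fin.
- by apply: integral_ge0 => t _; rewrite lee_fin.
apply: lte_mul_pinfty => //.
- by apply: integral_ge0 => t _; rewrite lee_fin.
- rewrite ge0_fin_numE; first exact: integral_oneDsqrV_lty.
  by apply: integral_ge0 => t _; rewrite lee_fin.
Qed.

(** Each [1 + x_i ^ 2] is at most [(1 + enorm x) ^ 2], so the weight of order [2 * n] dominates the
    product of these factors, whose inverse [Q] is integrable. *)
Lemma cintegrable_row n (u : 'rV[R]_n -> R[i]) (M : R) : continuous u ->
  (forall x, (1 + enorm x) ^+ (2 * n) * nrm (u x) <= M) ->
  cintegrable (lebesgue_Rn R n) (fun t => u (row_of_tuple t)).
Proof.
move=> cu Hu; split; first exact: cmeasurable_row.
have iQ : (lebesgue_Rn R n).-integrable setT (EFin \o @Q n).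
  apply/integrableP; split; first by apply/measurable_EFinP; exact: mQ.
  under eq_integral do rewrite gee0_abs ?lee_fin//.
  exact: integral_prod_oneDsqrV_lty.
apply: (le_integrable measurableT _ _ (integrableZl measurableT M iQ)).
  by apply/measurable_EFinP; exact: cmeasurable_nrm (cmeasurable_row cu).
move=> t _ /=; rewrite lee_fin ger0_norm ?nrm_ge0//.
set x := row_of_tuple t; apply: le_trans (ler_norm _).
have w0 : 0 < (1 + enorm x) ^+ (2 * n) by rewrite (lt_le_trans ltr01)// weight_ge1.
have QW : 1 <= (1 + enorm x) ^+ (2 * n) * Q t.
  rewrite exprM -[X in _ ^+ X]card_ord -prodr_const -big_split/=.
  elim/big_ind : _ => // [a b a1 b1|i _]; first exact: mulr_ege1.
  rewrite ler_pdivlMr ?mul1r; last first.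
    by rewrite (lt_le_trans ltr01)// oneDsqr_ge1.
  have := coord_le_enorm x i; rewrite mxE => xi.
  have : tnth t i ^+ 2 <= enorm x ^+ 2.
    by rewrite -real_normK ?num_real// lerXn2r ?nnegrE ?enorm_ge0.
  rewrite /oneDsqr; have := enorm_ge0 x; nra.
rewrite -(ler_pM2l w0) (le_trans (Hu x))// mulrCA ler_peMr//.
by rewrite (le_trans _ (Hu x))// mulr_ge0 ?nrm_ge0// ltW.
Qed.

End Decay.

Section ComplexFubini.
Context d1 d2 (T1 : measurableType d1) (T2 : measurableType d2) (R : realType).
Variables (m1 : {sigma_finite_measure set T1 -> \bar R})
  (m2 : {sigma_finite_measure set T2 -> \bar R}).

Lemma cintegrable_prod (f : T1 -> R[i]) (g : T2 -> R[i]) :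
  cintegrable m1 f -> cintegrable m2 g ->
  cintegrable (m1 \x m2)%E (fun p => f p.1 * g p.2).
Proof.
move=> [mf intf] [mg intg].
have mfg : cmeasurable (fun p : T1 * T2 => f p.1 * g p.2).
  apply: cmeasurableM; split.
  - exact: (measurableT_comp mf.1 measurable_fst).
  - exact: (measurableT_comp mf.2 measurable_fst).
  - exact: (measurableT_comp mg.1 measurable_snd).
  - exact: (measurableT_comp mg.2 measurable_snd).
split=> //; apply/integrable12ltyP.
  by apply/measurable_EFinP; exact: cmeasurable_nrm.
have nf x : (0 <= (nrm (f x))%:E)%E by rewrite lee_fin nrm_ge0.
have ng x : (0 <= (nrm (g x))%:E)%E by rewrite lee_fin nrm_ge0.
have mnf : measurable_fun setT (fun x => (nrm (f x))%:E).
  by apply/measurable_EFinP; exact: cmeasurable_nrm.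
have mng : measurable_fun setT (fun x => (nrm (g x))%:E).
  by apply/measurable_EFinP; exact: cmeasurable_nrm.
under eq_integral.
  move=> x _; under eq_integral do rewrite /= nrmM ger0_norm ?mulr_ge0 ?nrm_ge0// EFinM.
  rewrite ge0_integralZl//; over.
rewrite ge0_integralZr//; last by apply: integral_ge0.
move: intf intg => /integrableP[_ intf] /integrableP[_ intg].
apply: lte_mul_pinfty; first exact: integral_ge0.
  rewrite ge0_fin_numE; last exact: integral_ge0.
  by under eq_integral do rewrite -[(nrm _)%:E]gee0_abs//.
by under eq_integral do rewrite -[(nrm _)%:E]gee0_abs//.
Qed.

(** Integrability of every section makes the inner integrals finite everywhere, so [fine] can be
    removed pointwise. *)
Lemma cint_Fubini (F : T1 * T2 -> R[i]) : cintegrable (m1 \x m2)%E F ->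
  (forall x, cintegrable m2 (fun y => F (x, y))) ->
  (forall y, cintegrable m1 (fun x => F (x, y))) ->
  cint m1 (fun x => cint m2 (fun y => F (x, y))) =
  cint m2 (fun y => cint m1 (fun x => F (x, y))).
Proof.
move=> iF i2 i1; rewrite /cint /=.
have H (h : R[i] -> R) : (m1 \x m2)%E.-integrable setT (EFin \o (fun p => h (F p))) ->
    (forall x, m2.-integrable setT (EFin \o (fun y => h (F (x, y))))) ->
    (forall y, m1.-integrable setT (EFin \o (fun x => h (F (x, y))))) ->
    \int[m1]_x (\int[m2]_y h (F (x, y))) = \int[m2]_y (\int[m1]_x h (F (x, y))).
  move=> ih h2 h1; rewrite /Rintegral; congr fine.
  transitivity (\int[m1]_x \int[m2]_y (h (F (x, y)))%:E)%E.
    by apply: eq_integral => x _; rewrite fineK//; exact: (integrable_fin_num measurableT (h2 x)).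
  rewrite (Fubini ih).
  by apply: eq_integral => y _; rewrite fineK//; exact: (integrable_fin_num measurableT (h1 y)).
congr (_ +i* _); apply: H => *.
- exact: cintegrable_Re.
- exact: cintegrable_Re.
- exact: cintegrable_Re.
- exact: cintegrable_Im.
- exact: cintegrable_Im.
- exact: cintegrable_Im.
Qed.

End ComplexFubini.

(** * Approximation by convolutions *)

Section FiniteApproximation.
Context d (T : measurableType d) (R : realType) (E : normedModType R[i]).

(** Choosing the first close element of the list makes each cell a Boolean combination of the
    measurable sets given. *)
Lemma finite_approximation (G : T -> E) (eta : R) (vs : seq E) :
  (forall v, measurable [set t | nrm (G t - v) < eta]) ->
  (forall t, exists2 v, v \in vs & nrm (G t - v) < eta) ->
  exists (k : nat) (idx : T -> 'I_k) (v : 'I_k -> E),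
    (forall i, measurable (idx @^-1` [set i])) /\
    forall t, nrm (G t - v (idx t)) < eta.
Proof.
move=> mG cover; pose p t v := nrm (G t - v) < eta.
exists (size vs).+1, (fun t => inord (find (p t) vs)), (fun i => nth 0 vs i).
split=> [i|t]; last first.
  have hp : has (p t) vs by apply/hasP; exact: cover.
  rewrite inordK; first exact: (nth_find 0 hp).
  by rewrite ltnS find_size.
rewrite (_ : _ @^-1` _ = [set t | find (p t) vs = i]); last first.
  apply/seteqP; split => t /= ti; first by rewrite -ti inordK// ltnS find_size.
  by apply/val_inj; rewrite /= inordK ti.
move: (nat_of_ord i) => {i} m; elim: vs m {cover} => [|v vs IH] [|k] /=.
- by rewrite (_ : [set _ | _] = setT)//; apply/seteqP; split.
- by rewrite (_ : [set _ | _] = set0)//; apply/seteqP; split.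
- rewrite (_ : [set _ | _] = [set t | p t v]); first exact: mG.
  by apply/seteqP; split => t /=; case: (p t v).
- rewrite (_ : [set _ | _] = ~` [set t | p t v] `&` [set t | find (p t) vs = k]).
    by apply: measurableI; [apply: measurableC; exact: mG|exact: IH].
  apply/seteqP; split => t /=; case: (p t v) => //=; first by move=> [].
    by case.
  by move=> [_ ->].
Qed.

End FiniteApproximation.

Section Vanishing.
Context (R : realType) (n : nat) (E : normedModType R[i]).
Local Notation RT := (measurableTypeR R).

Lemma vanishing_approximation (G : 'rV[R]_n -> E) (eta : R) : continuous G ->
  0 < eta -> (exists r : R, forall y, r <= enorm y -> nrm (G y) < eta) ->
  exists (k : nat) (idx : n.-tuple RT -> 'I_k) (v : 'I_k -> E),
    (forall i, measurable (idx @^-1` [set i])) /\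
    forall t, nrm (G (row_of_tuple t) - v (idx t)) < eta.
Proof.
move=> cG eta0 [r Gr].
(* A ball for the max norm, which contains the Euclidean ball of the same radius. *)
pose B := [set y : 'rV[R]_n | `|y| <= r].
have cB : compact B.
  apply: bounded_closed_compact.
    by exists r; split => [|M rM x /= /le_trans]; [exact: num_real|apply; exact: ltW].
  apply: (@preimage_closed _ _ (fun y : 'rV[R]_n => `|y|) [set t | t <= r]).
    by move=> y _; exact: norm_continuous.
  exact: closed_le.
pose U (y : 'rV[R]_n) := [set x | nrm (G x - G y) < eta].
have cnG v : continuous (fun x => nrm (G x - v)).
  move=> x; apply: (@continuous_comp _ _ _ (fun x => G x - v) (@nrm R E)).
    exact: (@cvgB _ E _ _ _ G (cst v) (G x) v (cG x) (cvg_cst v)).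
  exact: nrm_continuous.
have oU y : setT y -> open (U y).
  move=> _; apply: (@open_comp _ _ (fun x => nrm (G x - G y)) [set t | t < eta]).
    by move=> x _; exact: cnG.
  exact: open_lt.
have BU : B `<=` \bigcup_(y in setT) U y.
  by move=> y _; exists y => //; rewrite /U/= subrr nrm0.
rewrite compact_cover in cB; have [D' _ BD'] := cB _ _ _ oU BU.
(* The value 0 serves outside the ball, the centres of the finite subcover inside it. *)
apply: (@finite_approximation _ (n.-tuple RT) _ _ (fun t => G (row_of_tuple t)) _
  (0 :: [seq G y | y <- finmap.enum_fset D'])) => [v|t].
  rewrite -[X in measurable X]setTI.
  have mn := measurable_row (cnG v).
  rewrite (_ : [set _ | _] = (fun t => nrm (G (row_of_tuple t) - v)) @^-1` `]-oo, eta[).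
    by apply: mn => //; exact: measurable_itv.
  by apply/seteqP; split => t /=; rewrite in_itv.
have [rt|tr] := leP r (enorm (row_of_tuple t)).
  by exists 0; [rewrite inE eqxx|rewrite subr0; exact: Gr].
have [|y /= yD Uy] := BD' (row_of_tuple t).
  by rewrite /B/= (le_trans (norm_le_enorm _))// ltW.
by exists (G y) => //; rewrite inE map_f ?orbT.
Qed.

Lemma linear_bounded (l : {linear E -> R[i]}) : continuous l ->
  exists B : R, forall x, nrm (l x) <= B * nrm x.
Proof.
move=> cl.
have : nbhs (0 : E) [set x | nrm (l 0 - l x) < 1].
  exact: ((cvg_nrmP _ _ (nbhs_filter _)).1 (cl 0) 1 ltr01).
rewrite linear0 => /nbhs_nrm[dl dl0 Hdl].
exists (2 / dl) => x; have [->|x0] := eqVneq x 0.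
  by rewrite linear0 !nrm0 mulr0.
have nx : 0 < nrm x by rewrite lt_def nrm_ge0 nrm_eq0 x0.
pose a := dl / (2 * nrm x).
have a0 : 0 < a by rewrite divr_gt0 ?mulr_gt0.
have := Hdl (a%:C *: x); rewrite /= !sub0r !nrmN nrmZr gtr0_norm//.
have lZ : l (a%:C *: x) = a%:C * l x by exact: linearZ.
rewrite lZ nrmM nrm_real gtr0_norm// => H.
have {}H : a * nrm (l x) < 1.
  by apply: H; rewrite /a invfM mulrA divfK ?gt_eqF// ltr_pdivrMr// ltr_pMr// ltr1n.
rewrite -(ler_pM2l a0) (le_trans (ltW H))// /a.
by rewrite le_eqVlt; apply/orP; left; apply/eqP; field; rewrite !gt_eqF.
Qed.

End Vanishing.

Lemma continuous_after (T U V : topologicalType) (f : T -> U) (g : U -> V) :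
  continuous f -> continuous g -> continuous (fun x => g (f x)).
Proof. by move=> cf cg x; exact: continuous_comp (cf x) (cg (f x)). Qed.

Section ComplexContinuous.
Context (R : realType) (T : topologicalType).

Lemma continuous_cmul (u v : T -> R[i]) : continuous u -> continuous v ->
  continuous (fun x => u x * v x).
Proof. by move=> cu cv x; exact: (@cvgM _ _ (nbhs x) _ u v _ _ (cu x) (cv x)). Qed.

Lemma continuous_realC (w : T -> R) : continuous w -> continuous (fun x => (w x)%:C).
Proof.
move=> cw x; apply/(cvg_nrmP _ _ (nbhs_filter x)) => e e0.
have := (@cvgrPdist_lt R R _ (nbhs x) (nbhs_filter x) w (w x)).1 (cw x) e e0.
by apply: filterS => y; rewrite -rmorphB nrm_real.
Qed.

Lemma continuous_affine n (x : 'rV[R]_n) (a : R) :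
  continuous (fun y : 'rV[R]_n => x + a *: y).
Proof.
move=> y; apply: (@cvgD _ 'rV[R]_n _ (nbhs y) (nbhs_filter y) (cst x) ( *:%R a)).
  exact: (cvg_cst x).
exact: (@cvgZl_tmp _ _ _ (nbhs y) (nbhs_filter y) a id _ cvg_id).
Qed.

End ComplexContinuous.

(** * Convolutions paired with test functions *)

Section WeakIdentity.
Context (R : realType) (n : nat).
Local Notation RT := (measurableTypeR R).
Local Notation mu := (lebesgue_Rn R n).
Local Notation row := (@row_of_tuple R n).
Local Notation D := (test_function R n).
Local Notation S := (schwartz R n).
Implicit Types (phi : S) (psi chi : D).

Lemma schwartz_continuous phi : continuous phi.
Proof. by have /schwartzP[sp _] := valP phi; exact: (sp [::]).1. Qed.

Lemma test_continuous psi : continuous psi.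
Proof. exact: (test_smooth psi [::]).1. Qed.

(** Of the [2 * n + N] powers of decay, [N] pay for the weight and [2 * n] for integrability. *)
Lemma schwartz_weight_integrable phi N :
  cintegrable mu (fun t => phi (row t) * ((1 + enorm (row t)) ^+ N)%:C).
Proof.
have /schwartzP[_ bp] := valP phi; have [M HM] := bp (2 * n + N)%N [::].
apply: (@cintegrable_row _ _ (fun x => phi x * ((1 + enorm x) ^+ N)%:C) M).
  apply: continuous_cmul; first exact: schwartz_continuous.
  apply: continuous_realC; exact: weight_continuous.
move=> x; have := HM x; rewrite nrmE -rmorphM lecR; apply: le_trans.
rewrite nrmM nrm_real ger0_norm ?exprn_ge0 ?addr_ge0 ?enorm_ge0//.
by rewrite exprD -mulrA [nrm _ * _]mulrC.
Qed.

Lemma schwartz_integrable phi : cintegrable mu (fun t => phi (row t)).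
Proof.
have := schwartz_weight_integrable phi 0.
by congr cintegrable; apply/funext => t; rewrite expr0 mulr1.
Qed.

Lemma test_integrable psi : cintegrable mu (fun t => psi (row t)).
Proof. exact: (schwartz_integrable (schwartz_of_test psi)). Qed.

Lemma test_bounded psi : exists2 M : R, 0 < M & forall x, nrm (psi x) <= M.
Proof.
have [M M0 HM] := test_partials_weight psi 0 [::].
by exists M => // x; have := HM x; rewrite expr0 mul1r.
Qed.

Lemma continuous_subZ (x : 'rV[R]_n) (eps : R) :
  continuous (fun z : 'rV[R]_n => x - eps *: z).
Proof. by under eq_fun do rewrite -scaleNr; exact: continuous_affine. Qed.

Lemma cintegrable_bounded d (T : measurableType d) (m : {measure set T -> \bar R})
    (f b : T -> R[i]) (M : R) : cintegrable m f -> cmeasurable b ->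
  (forall t, nrm (b t) <= M) -> cintegrable m (fun t => f t * b t).
Proof.
move=> intf mb bM; apply: (@cintegrable_le _ _ _ _ _ f M) => //.
  by apply: cmeasurableM => //; case: intf.
by move=> t; rewrite nrmM mulrC ler_wpM2r ?nrm_ge0.
Qed.

Lemma convolution_integrable (eps : R) phi psi (x : 'rV[R]_n) :
  cintegrable mu (fun t => phi (row t) * psi (x - eps *: row t)).
Proof.
have [M M0 HM] := test_bounded psi.
apply: (@cintegrable_bounded _ _ _ _ _ M) => //; first exact: schwartz_integrable.
apply: (cmeasurable_row (u := fun z => psi (x - eps *: z))).
move=> z; apply: (@continuous_comp 'rV[R]_n 'rV[R]_n R[i] (fun z => x - eps *: z) psi).
  exact: continuous_subZ.
exact: test_continuous.
Qed.

(** Substituting [x - eps *: z] produces the Jacobian [eps ^+ n], which cancels the normalisation of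
    [rescale]. *)
Lemma convolution_rescaleE (eps : R) phi psi x : 0 < eps ->
  convolution_fun (rescale eps phi) psi x =
  cint mu (fun t => phi (row t) * psi (x - eps *: row t)).
Proof.
move=> e0; have ne0 : - eps != 0 by rewrite oppr_eq0 gt_eqF.
rewrite /convolution_fun (integral_Rn_affine x ne0); last first.
  apply: continuous_cmul; last exact: test_continuous.
  apply: (@continuous_after 'rV[R]_n 'rV[R]_n R[i] (fun y => x - y) (rescale eps phi)).
    by under eq_fun do rewrite -scaleN1r; exact: continuous_affine.
  exact: schwartz_continuous.
rewrite normrN gtr0_norm//.
rewrite (_ : (fun y => _ * _) = fun z => (eps ^- n)%:C * (phi z * psi (x - eps *: z))).
  rewrite -[integral_Rn _]/(cint mu (fun t => (eps ^- n)%:C *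
    (phi (row t) * psi (x - eps *: row t)))).
  rewrite cintZ; last exact: convolution_integrable.
  by rewrite mulrA -rmorphM mulfV ?mul1r// expf_neq0// gt_eqF.
apply/funext => z; rewrite scaleNr mulrA; congr (_ * _).
rewrite -[LHS]/((eps ^- n)%:C * phi (eps^-1 *: (x - (x - eps *: z)))).
by rewrite opprB addrC subrK scalerA mulVf ?gt_eqF// scale1r.
Qed.

(** Fubini exhibits the convolution as an average of translates of [psi] with density [phi]; the
    double integrand is integrable because [psi] is bounded. *)
Lemma convolution_pairing (eps : R) phi psi chi : 0 < eps ->
  integral_Rn (fun x => convolution_fun (rescale eps phi) psi x * chi x) =
  cint mu (fun t => phi (row t) *
    integral_Rn (fun x => translate_D (- (eps *: row t)) psi x * chi x)).
Proof.
move=> e0.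
pose F (p : n.-tuple RT * n.-tuple RT) : R[i] :=
  chi (row p.1) * phi (row p.2) * psi (row p.1 - eps *: row p.2).
have [M M0 HM] := test_bounded psi.
(* Joint measurability is checked coordinate by coordinate on tuples; [measurable_row] concerns a
   single row. *)
have msub : measurable_fun setT (fun p : n.-tuple RT * n.-tuple RT =>
    [tuple (tnth p.1 i - eps * tnth p.2 i : RT) | i < n]).
  apply/measurable_fun_tnthP => i.
  rewrite (_ : _ \o _ = fun p => tnth p.1 i - eps * tnth p.2 i).
    apply: measurable_funB; last apply: measurable_funM => //.
      exact: (measurableT_comp (measurable_tnth i) measurable_fst).
    exact: (measurableT_comp (measurable_tnth i) measurable_snd).
  by apply/funext => p /=; rewrite tnth_mktuple.
have [mpR mpI] := cmeasurable_row (@test_continuous psi).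
have iF : cintegrable (mu \x mu)%E F.
  apply: (@cintegrable_bounded _ _ _ _ _ M) => //.
    exact: (cintegrable_prod (test_integrable chi) (schwartz_integrable phi)).
  have rowE (p : n.-tuple RT * n.-tuple RT) : row p.1 - eps *: row p.2 =
      row [tuple (tnth p.1 i - eps * tnth p.2 i : RT) | i < n].
    by apply/rowP => i; rewrite !mxE tnth_mktuple.
  split; under eq_fun do rewrite rowE.
    exact: (measurableT_comp mpR msub).
  exact: (measurableT_comp mpI msub).
have i2 x : cintegrable mu (fun y => F (x, y)).
  under eq_fun do rewrite /F /= -mulrA.
  by apply: cintegrableZ; exact: convolution_integrable.
have trE y : (fun x => F (x, y)) = fun x => phi (row y) *
    (translate_D (- (eps *: row y)) psi (row x) * chi (row x)).
  by apply/funext => x; rewrite /F /= [chi _ * _]mulrC -mulrA [chi _ * _]mulrC.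
have itr y : cintegrable mu (fun x =>
    translate_D (- (eps *: row y)) psi (row x) * chi (row x)).
  have [M' M'0 HM'] := test_bounded chi.
  apply: (@cintegrable_bounded _ _ _ _ _ M') => //; first exact: test_integrable.
  by apply: cmeasurable_row; exact: test_continuous.
have i1 y : cintegrable mu (fun x => F (x, y)).
  by rewrite trE; exact: cintegrableZ.
transitivity (cint mu (fun x => cint mu (fun y => F (x, y)))).
  congr cint; apply/funext => x; rewrite convolution_rescaleE// mulrC -cintZ.
    by congr cint; apply/funext => y; rewrite /F mulrA.
  exact: convolution_integrable.
rewrite (cint_Fubini iF i2 i1); congr cint; apply/funext => y.
by rewrite trE cintZ.
Qed.

End WeakIdentity.

(** * Estimates for the difference and its limit *)

Section Approximation.
Context (R : realType) (n : nat) (E : completeNormedModType R[i])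
  (iota : {linear E -> distrib R n}) (hE : translation_invariant iota)
  (star : schwartz R n -> E -> E) (hstar : is_convolution iota star)
  (phi : schwartz R n).
Local Notation RT := (measurableTypeR R).
Local Notation mu := (lebesgue_Rn R n).
Local Notation row := (@row_of_tuple R n).
Local Notation D := (test_function R n).
Variable j : {linear D -> E}.
Hypothesis jreg : forall psi : D, is_regular psi (iota (j psi)).
Hypothesis jcont : continuous j.
Hypothesis jdense : dense (range j).
Let c := integral_Rn phi.

(** Distributional and pointwise translation agree on test functions, which carries the growth bound
    over to [j (translate_D h psi)]. *)
Lemma translate_testE h (psi : D) : is_translate h (iota (j psi)) (iota (j (translate_D h psi))).
Proof.
move=> chi; rewrite !jreg.
rewrite [RHS](@integral_Rn_affine R n h 1)// ?oner_neq0//; last first.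
  by apply: continuous_cmul; exact: test_continuous.
rewrite normr1 expr1n mul1r; congr integral_Rn; apply/funext => x.
rewrite scale1r; congr (psi _ * _); first by rewrite addrC.
rewrite -[RHS]/(chi (h + x - h)); congr (chi _).
by rewrite addrC addKr.
Qed.

Variables (C : R) (m : nat).
Hypothesis C0 : 0 < C.
Hypothesis jbound : forall h psi,
  nrm (j (translate_D h psi)) <= C * (1 + enorm h) ^+ m * nrm (j psi).

Let w (x : 'rV[R]_n) : R := (1 + enorm x) ^+ m.+1.

Let w_ge1 x : 1 <= w x.
Proof. exact: weight_ge1. Qed.

Let w_gt0 x : 0 < w x.
Proof. exact: lt_le_trans (w_ge1 x). Qed.

Let f (t : n.-tuple RT) : R[i] := phi (row t) * (w (row t))%:C.

Let intf : cintegrable mu f.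
Proof. exact: schwartz_weight_integrable. Qed.

Definition defect (eps : R) (g : E) : E := c *: g - star (rescale eps phi) g.

Definition shift_diff (eps : R) (psi : D) (y : 'rV[R]_n) : E :=
  j psi - j (translate_D (- (eps *: y)) psi).

(** By the group law, continuity at [y] is continuity at the zero shift for a translated test
    function. *)
Lemma shift_diff_continuous eps psi : continuous (shift_diff eps psi).
Proof.
move=> y; apply/(cvg_nrmP _ _ (nbhs_filter y)) => e e0.
have [d d0 Hd] := translate_D_cvg (translate_D (- (eps *: y)) psi) jcont e0.
have d'0 : 0 < d / (`|eps| + 1) by rewrite divr_gt0// ltr_wpDl.
have : nbhs y [set z | `|y - z| < d / (`|eps| + 1)].
  by apply/(@nbhs_normP R 'rV[R]_n y); exists (d / (`|eps| + 1)).
apply: filterS => z /= yz.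
have -> : shift_diff eps psi y - shift_diff eps psi z =
    j (translate_D (- (eps *: z)) psi) - j (translate_D (- (eps *: y)) psi).
  by rewrite /shift_diff opprB addrC addrA subrK.
have -> : translate_D (- (eps *: z)) psi =
    translate_D (eps *: (y - z)) (translate_D (- (eps *: y)) psi).
  apply/val_inj/funext => x.
  rewrite -[LHS]/(psi (x - eps *: z)) -[RHS]/(psi (x + eps *: (y - z) - eps *: y)).
  by rewrite scalerBr -!addrA [- _ - _]addrC addNKr.
apply: Hd; rewrite normrZ (@le_lt_trans _ _ ((`|eps| + 1) * `|y - z|))//.
  by rewrite ler_wpM2r// lerDl.
by rewrite mulrC -ltr_pdivlMr// ltr_wpDl.
Qed.

(** For [eps <= 1] the shift [eps *: y] is no longer than [y], so the bound does not depend on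
    [eps]. *)
Lemma shift_diff_growth eps psi y : 0 < eps <= 1 ->
  nrm (shift_diff eps psi y) <= (1 + C) * nrm (j psi) * (1 + enorm y) ^+ m.
Proof.
move=> /andP[e0 e1]; have ny := enorm_ge0 y.
have h1 : 1 <= (1 + enorm y) ^+ m by exact: weight_ge1.
rewrite (le_trans (nrmB _ _))// mulrDl mul1r mulrDl lerD//.
  by rewrite ler_peMr ?nrm_ge0.
rewrite (le_trans (jbound _ _))// [leRHS]mulrAC ler_wpM2r ?nrm_ge0//.
rewrite ler_wpM2l ?(ltW C0)// lerXn2r ?nnegrE ?addr_ge0 ?enorm_ge0//.
by rewrite lerD2l -scaleNr enormZ normrN gtr0_norm// ler_piMl.
Qed.

Lemma shift_diff_integrable eps psi chi : 0 < eps <= 1 ->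
  cintegrable mu (fun t => phi (row t) * iota (shift_diff eps psi (row t)) chi).
Proof.
move=> e01.
have cl := @iota_eval_continuous _ _ _ _ chi (iota_continuous hE).
have [B HB] := linear_bounded cl.
apply: (@cintegrable_le _ _ _ _ _ f (`|B| * ((1 + C) * nrm (j psi)))) => //.
  apply: cmeasurableM.
    apply: (cmeasurable_row (u := phi)); exact: schwartz_continuous.
  apply: (cmeasurable_row (u := fun y => iota_eval iota chi (shift_diff eps psi y))).
  exact: (continuous_after (@shift_diff_continuous eps psi) cl).
move=> t; rewrite nrmM /f [nrm (phi _ * _)]nrmM mulrCA ler_wpM2l ?nrm_ge0//.
rewrite nrm_real [`|w _|]gtr0_norm// (le_trans (HB _))//.
apply: (@le_trans _ _ (`|B| * nrm (shift_diff eps psi (row t)))).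
  by rewrite ler_wpM2r ?nrm_ge0// ler_norm.
rewrite -mulrA ler_wpM2l// (le_trans (shift_diff_growth _ _ e01))//.
rewrite ler_wpM2l ?mulr_ge0 ?nrm_ge0 ?addr_ge0 ?(ltW C0)//.
by rewrite /w ler_weXn2l// lerDl enorm_ge0.
Qed.

Lemma iota_defect eps psi chi : 0 < eps <= 1 ->
  iota (defect eps (j psi)) chi =
    cint mu (fun t => phi (row t) * iota (shift_diff eps psi (row t)) chi).
Proof.
move=> e01; have /andP[e0 e1] := e01.
have iD := shift_diff_integrable psi chi e01.
have iP := schwartz_integrable phi.
pose a := iota (j psi) chi.
have iPa : cintegrable mu (fun t => a * phi (row t)) by exact: cintegrableZ.
have -> : iota (defect eps (j psi)) chi =
    c * a - iota (star (rescale eps phi) (j psi)) chi.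
  rewrite -[LHS]/(iota_eval iota chi (c *: j psi - star (rescale eps phi) (j psi))).
  by rewrite linearB; congr (_ - _); exact: linearZ.
have jr : is_regular (schwartz_of_test psi) (iota (j psi)) by exact: jreg.
rewrite (hstar.2 (rescale eps phi) _ _ jr) convolution_pairing//.
have -> : c * a = cint mu (fun t => a * phi (row t)) by rewrite cintZ// mulrC.
rewrite (_ : (fun t => phi (row t) * integral_Rn _) = fun t =>
   a * phi (row t) - phi (row t) * iota (shift_diff eps psi (row t)) chi).
  by rewrite cintB// subKr.
apply/funext => t; rewrite -jreg [a * _]mulrC -mulrBr; congr (_ * _).
rewrite -[RHS]/(a - iota_eval iota chi (j psi - j (translate_D (- (eps *: row t)) psi))).
by rewrite linearB subKr.
Qed.

(* The weight w is moved from the difference to phi: the quotient by w of the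
   difference tends to 0 at infinity, hence is uniformly close to a step
   function, and w phi is still integrable. *)
Lemma defect_norm_le eps psi (K : R) : 0 < eps <= 1 ->
  (forall y, nrm (shift_diff eps psi y) <= K * w y) ->
  nrm (defect eps (j psi)) <= 2 * K * absint mu f.
Proof.
move=> e01 HK.
pose G y := (w y)^-1%:C *: shift_diff eps psi y.
have nG y : nrm (G y) = (w y)^-1 * nrm (shift_diff eps psi y).
  by rewrite nrmZr gtr0_norm// invr_gt0.
have GK y : nrm (G y) <= K by rewrite nG ler_pdivrMl// mulrC.
have cG : continuous G.
  have cw : continuous (fun y => ((w y)^-1)%:C).
    apply: continuous_realC => y.
    exact: (@cvgV _ _ (nbhs y) (nbhs_filter y) w (w y) (lt0r_neq0 (w_gt0 y))
      (@weight_continuous _ _ m.+1 y)).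
  move=> y; exact: (@cvgZ _ _ _ (nbhs y) (nbhs_filter y) _ _ _ _ (cw y)
    (@shift_diff_continuous eps psi y)).
have GE t chi : f t * iota_eval iota chi (G (row t)) =
    phi (row t) * iota (shift_diff eps psi (row t)) chi.
  have -> : iota_eval iota chi (G (row t)) =
      (w (row t))^-1%:C * iota (shift_diff eps psi (row t)) chi by exact: linearZ.
  by rewrite /f mulrA -[phi _ * _ * _]mulrA -rmorphM mulfV ?gt_eqF// mulr1.
apply: (@weak_integral_norm_le _ _ _ _ _ D (fun chi => iota_eval iota chi) f (fun t => G (row t))) => //.
- move=> eta eta0; apply: vanishing_approximation => //.
  (* [w] has one factor [1 + enorm y] more than the growth bound, and it exceeds [B / eta] from
     there on. *)
  pose B := (1 + C) * nrm (j psi); exists (B / eta) => y yB.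
  rewrite nG ltr_pdivrMl//.
  apply: le_lt_trans (shift_diff_growth psi y e01) _; rewrite -/B mulrC /w exprSr -[ltRHS]mulrA.
  rewrite ltr_pM2l ?(lt_le_trans ltr01 (weight_ge1 _ _))//.
  by rewrite mulrDl mul1r ltr_pwDl// -ler_pdivrMr.
- by move=> chi; exact: (iota_eval_continuous (iota_continuous hE)).
- by move=> x y xy; apply: (eq_iota (iota_inj hE)) => chi; exact: xy.
- move=> chi; have := shift_diff_integrable psi chi e01.
  by congr cintegrable; apply/funext => t; rewrite GE.
- move=> chi; rewrite [LHS](iota_defect psi chi e01).
  by congr cint; apply/funext => t; rewrite GE.
Qed.

(** Additivity of [star] is not part of [is_convolution]; on the range of [j] it is read off the
    integral formula [iota_defect]. *)
Lemma defectB eps psi psi' : 0 < eps <= 1 ->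
  defect eps (j psi) - defect eps (j psi') = defect eps (j (psi - psi')).
Proof.
move=> e01; apply: (eq_iota (iota_inj hE)) => chi.
have tB h : translate_D h (psi - psi') = translate_D h psi - translate_D h psi'.
  exact/val_inj.
rewrite iota_defect//.
transitivity (iota (defect eps (j psi)) chi - iota (defect eps (j psi')) chi).
  exact: (linearB (iota_eval iota chi)).
rewrite !iota_defect// -cintB; try exact: shift_diff_integrable.
congr cint; apply/funext => t; rewrite -mulrBr; congr (_ * _).
rewrite -[RHS]/(iota_eval iota chi _).
have -> : shift_diff eps (psi - psi') (row t) =
    shift_diff eps psi (row t) - shift_diff eps psi' (row t).
  rewrite /shift_diff tB [j (psi - _)]linearB [j (_ - _)]linearB !opprB addrACA [RHS]addrACA.
  by congr (_ + _); exact: addrC.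
by rewrite -[LHS](linearB (iota_eval iota chi)).
Qed.

Lemma defect_continuous eps : continuous (defect eps).
Proof.
move=> g; have cs : star (rescale eps phi) x @[x --> g] --> star (rescale eps phi) g.
  apply: (@cvg_comp _ _ _ (fun x : E => (rescale eps phi, x))
    (fun p : schwartz R n * E => star p.1 p.2) _ (nbhs (rescale eps phi, g))).
    exact: (@cvg_pair _ _ _ (nbhs g) _ _ (nbhs_filter g) _ _ (cst (rescale eps phi)) id (cvg_cst _) cvg_id).
  exact: (hstar.1 (rescale eps phi, g)).
apply: (@cvgB _ E _ (nbhs g) (nbhs_filter g) (fun x => c *: x)) => //.
exact: (@cvgZl_tmp _ _ _ (nbhs g) (nbhs_filter g) c id _ cvg_id).
Qed.

Lemma range_dense (g : E) (e : R) : 0 < e -> exists psi : D, nrm (g - j psi) < e.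
Proof.
move=> e0; pose O := [set x | nrm (g - x) < e]°.
have gO : O g by apply/nbhs_nrm; exists e.
have [x [Ox [psi _ jx]]] := jdense (ex_intro _ g gO) (@open_interior _ _).
by exists psi; rewrite jx; exact: (interior_subset Ox).
Qed.

(** For [g] in the range of [j], [defectB] and the growth bound give a constant free of [eps]; both
    sides are continuous in [g]. *)
Lemma defect_lipschitz eps g psi : 0 < eps <= 1 ->
  nrm (defect eps g - defect eps (j psi)) <= 2 * (1 + C) * absint mu f * nrm (g - j psi).
Proof.
move=> e01; pose L := 2 * (1 + C) * absint mu f.
pose h (x : E) := nrm (defect eps x - defect eps (j psi)) - L * nrm (x - j psi).
have ch : continuous h.
  have cd : continuous (fun x => defect eps x - defect eps (j psi)).
    move=> x; exact: (@cvgB _ E _ (nbhs x) (nbhs_filter x) (defect eps) (cst _) _ _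
      (@defect_continuous eps x) (cvg_cst _)).
  have cj : continuous (fun x : E => x - j psi).
    move=> x; exact: (@cvgB _ E _ (nbhs x) (nbhs_filter x) id (cst _) _ _ cvg_id (cvg_cst _)).
  have c1 := continuous_after cd (@nrm_continuous R E).
  have c2 := continuous_after cj (@nrm_continuous R E).
  move=> x; exact: (@cvgB _ _ _ (nbhs x) (nbhs_filter x) _ _ _ _ (c1 x)
    (@cvgM _ _ (nbhs x) (nbhs_filter x) (cst L) _ _ _ (cvg_cst _) (c2 x))).
suff : h g <= 0 by rewrite subr_le0.
apply: closed_nrm_le (ch g) _ => e e0.
have [psi' g'] := range_dense g e0; exists (j psi') => //.
rewrite subr_le0 defectB// -linearB /L [leRHS]mulrAC -[2 * _ * _]mulrA.
apply: defect_norm_le => // y; rewrite (le_trans (shift_diff_growth _ _ e01))//.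
rewrite ler_wpM2l ?mulr_ge0 ?nrm_ge0 ?addr_ge0 ?(ltW C0)//.
by rewrite /w ler_weXn2l// lerDl enorm_ge0.
Qed.

Lemma defect_test_cvg psi (e : R) : 0 < e -> exists2 d : R, 0 < d &
  forall eps, 0 < eps < d -> nrm (defect eps (j psi)) < e.
Proof.
move=> e0; have A0 := absint_ge0 mu f.
pose eta := e / (2 * absint mu f + 1).
have p0 : 0 < 2 * absint mu f + 1 by rewrite ltr_wpDl// mulr_ge0.
have eta0 : 0 < eta by rewrite divr_gt0.
have [d d0 Hd] := translate_D_cvg psi jcont eta0.
pose B := (1 + C) * nrm (j psi).
have B0 : 0 <= B by rewrite mulr_ge0 ?nrm_ge0 ?addr_ge0 ?(ltW C0).
(* Beyond [r] the spare factor of [w] beats the growth bound; within [r] the shift [eps *: y] is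
   shorter than [d]. The [r + 1] below avoids division by 0. *)
pose r := B / eta.
have r0 : 0 <= r by rewrite divr_ge0// ltW.
have r10 : 0 < r + 1 by rewrite ltr_wpDl.
exists (Num.min 1 (d / (r + 1))); first by rewrite lt_min ltr01 divr_gt0.
move=> eps /andP[ep0]; rewrite lt_min => /andP[ep1 epd].
have e01 : 0 < eps <= 1 by rewrite ep0 ltW.
apply: (@le_lt_trans _ _ (2 * eta * absint mu f)).
  apply: defect_norm_le => // y; have ny := enorm_ge0 y.
  have [ry|yr] := leP r (enorm y).
    apply: le_trans (shift_diff_growth psi y e01) _; rewrite -/B /w exprS mulrA.
    rewrite ler_wpM2r ?exprn_ge0 ?addr_ge0//.
    by rewrite mulrDr mulr1 ler_wpDl ?(ltW eta0)// mulrC -ler_pdivrMr.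
  apply: (@le_trans _ _ eta); last by rewrite ler_peMr ?(ltW eta0).
  rewrite /shift_diff nrmBC ltW//; apply: Hd.
  rewrite -scaleNr normrZ normrN gtr0_norm//.
  apply: le_lt_trans (_ : eps * (r + 1) < _); last by rewrite -ltr_pdivlMr.
  rewrite ler_wpM2l ?(ltW ep0)// (le_trans (norm_le_enorm y))//.
  by rewrite (le_trans (ltW yr))// lerDl.
rewrite mulrAC /eta mulrA ltr_pdivrMr//.
by rewrite mulrC ltr_pM2l// ltrDl.
Qed.

Lemma defect_cvg g (e : R) : 0 < e -> exists2 d : R, 0 < d &
  forall eps, 0 < eps < d -> nrm (defect eps g) < e.
Proof.
move=> e0; pose L := 2 * (1 + C) * absint mu f.
have L0 : 0 <= L by rewrite !mulr_ge0 ?absint_ge0 ?addr_ge0 ?(ltW C0).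
have L10 : 0 < L + 1 by rewrite ltr_wpDl.
have e20 : 0 < e / 2 by rewrite divr_gt0.
(* Through the Lipschitz constant [L] this precision costs less than [e / 2], uniformly in [eps]. *)
have [psi gpsi] := range_dense g (divr_gt0 e20 L10).
have [d d0 Hd] := defect_test_cvg psi e20.
exists (Num.min 1 d); first by rewrite lt_min ltr01.
move=> eps /andP[ep0]; rewrite lt_min => /andP[ep1 epd].
have h1 := @defect_lipschitz eps g psi; rewrite ep0 (ltW ep1) -/L in h1.
have h2 := Hd eps; rewrite ep0 epd in h2.
have h3 := nrmD (defect eps g - defect eps (j psi)) (defect eps (j psi)).
rewrite subrK in h3; rewrite ltr_pdivlMr// in gpsi.
have := h1 isT; have := h2 isT; have := nrm_ge0 (g - j psi); nra.
Qed.

End Approximation.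

Theorem corollary1 (R : realType) (n : nat) (E : completeNormedModType R[i])
    (iota : {linear E -> distrib R n})
    (hE : translation_invariant iota)
    (star : schwartz R n -> E -> E) (hstar : is_convolution iota star)
    (g : E) (phi : schwartz R n) :
  let c := integral_Rn phi in
  `|c *: g - star (rescale eps phi) g| @[eps --> (0 : R)^'+] --> (0 : R[i]).
Proof.
move=> c; have [j [jreg jcont jdense]] := test_embedding hE.
have [Tr TrE] := translation_exists hE.
have [C [m [C0 HC]]] := Tr_uniform_bound hE TrE.
have jbound h (psi : test_function R n) :
    nrm (j (translate_D h psi)) <= C * (1 + enorm h) ^+ m * nrm (j psi).
  rewrite (translate_unique hE (translate_testE jreg h psi) (TrE h (j psi))).
  exact: HC.
apply/cvg_nrmP => e e0.
have [d d0 Hd] := defect_cvg hE hstar phi jreg jcont jdense C0 jbound g e0.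
near=> eps.
rewrite sub0r nrmN nrmE nrm_real ger0_norm ?nrm_ge0//; apply: Hd.
apply/andP; split; near: eps.
  exact: nbhs_right_gt.
exact: nbhs_right_lt.
Unshelve. all: by end_near. Qed.
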